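(* Consider the scale-free percolation model $\mathrm{SFP}_W$ on $\mathbb{Z}^d$ with $\lambda>0$, $\alpha>d$, $\tau>1$ and $\gamma=\alpha(\tau-1)/d\in(1,2)$. Then, as $\|x\|\to\infty$, $$\frac{\mathrm{d}_G(0,x)}{\log\log\|x\|}\to\frac{2}{|\log(\gamma-1)|}\qquad\text{in probability,}$$ i.e. for every $\varepsilon>0$, $\lim_{\|x\|\to\infty}\mathbb{P}\big(\big|\mathrm{d}_G(0,x)/\log\log\|x\|-2/|\log(\gamma-1)|\big|>\varepsilon\big)=0$.
   Context: Scale-free percolation model $\mathrm{SFP}_W$. Fix $d\ge1$, $\alpha>d$ and $\lambda>0$. Each $x\in\mathbb{Z}^d$ gets an i.i.d. vertex-weight $W_x$ distributed as $W$, where $\mathbb{P}(W\ge1)=1$ and $\mathbb{P}(W>t)=\ell(t)/t^{\tau-1}$, with $\tau>1$ and $\ell$ slowly varying at infinity. Conditionally on $(W_x)_{x\in\mathbb{Z}^d}$, edges are present independently: each pair $x,y$ with $\|x-y\|=1$ (Euclidean norm) is always connected by an edge, and each pair with $\|x-y\|>1$ is connected with probability $1-\exp\{-\lambda W_xW_y/\|x-y\|^\alpha\}$. Set $\gamma:=\alpha(\tau-1)/d$. $\mathrm{d}_G(x,y)$ denotes the graph distance (minimal number of edges on a path between $x$ and $y$). *)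

(* Defs.v *)
From HB Require Import structures.
From mathcomp Require Import all_boot all_order all_algebra.
From mathcomp Require Import all_classical all_reals all_analysis.

Set Implicit Arguments.
Unset Strict Implicit.
Unset Printing Implicit Defensive.
Import Order.TTheory GRing.Theory Num.Theory.
Import numFieldNormedType.Exports.

Local Open Scope classical_set_scope.
Local Open Scope ring_scope.

Notation site d := 'rV[int]_d.

Definition enorm (R : realType) (d : nat) (x : site d) : R :=
  Num.sqrt (\sum_(i < d) ((x ord0 i)%:~R : R) ^+ 2).

Definition norm_to_infinity (R : realType) (d : nat) : set_system (site d) :=
  filter_from [set: R] (fun M => [set x : site d | M < enorm R x]).

Arguments norm_to_infinity : clear implicits.

#[global] Instance norm_to_infinity_filter (R : realType) (d : nat) :
  Filter (norm_to_infinity R d).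
Proof.
apply: filter_fromT_filter; first by exists 0.
move=> M N; exists (Num.max M N) => x /=.
by rewrite gt_max => /andP[].
Qed.

Definition slowly_varying (R : realType) (l : R -> R) : Prop :=
  (exists2 X : R, measurable_fun `]X, +oo[ l & forall t, X < t -> 0 < l t) /\
  (forall a : R, 0 < a -> l (a * t) / l t @[t --> +oo] --> (1 : R)).

Definition mutually_independent (disp : measure_display)
    (T : measurableType disp) (R : realType) (P : probability T R)
    (I : eqType) (X : I -> {RV P >-> R}) : Prop :=
  forall (s : seq I) (B : I -> set R), uniq s ->
    (forall i, measurable (B i)) ->
    P (\bigcap_(i in [set` s]) X i @^-1` B i) =
      (\prod_(i <- s) P (X i @^-1` B i))%E.

(* The sigma-algebra on the sample space generated by the family X. *)
Definition sigma_generated (disp : measure_display) (T : measurableType disp)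
    (R : realType) (P : probability T R) (I : Type) (X : I -> {RV P >-> R}) :
    set (set T) :=
  <<s [set A | exists i, exists2 B : set R, measurable B & A = X i @^-1` B] >>.

(* f is a version of the conditional probability of A given the
   sub-sigma-algebra F. *)
Definition is_cond_prob (disp : measure_display) (T : measurableType disp)
    (R : realType) (P : probability T R) (F : set (set T)) (A : set T)
    (f : T -> R) : Prop :=
  (forall B : set R, measurable B -> F (f @^-1` B)) /\
  (forall C : set T, F C -> P (A `&` C) = (\int[P]_(w in C) (f w)%:E)%E).

(* No pair may occur in both orientations: s lists distinct unordered pairs. *)
Definition long_pairs (R : realType) (d : nat) (s : seq (site d * site d)) :
    Prop :=
  uniq s /\
  forall e, e \in s -> 1 < enorm R (e.1 - e.2) /\ (e.2, e.1) \notin s.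

Definition edge_prob (R : realType) (d : nat) (lambda alpha : R)
    (w : site d -> R) (e : site d * site d) : R :=
  1 - expR (- (lambda * w e.1 * w e.2 / enorm R (e.1 - e.2) `^ alpha)).

Definition weight_law (R : realType) (tau : R) (l : R -> R)
    (mu : probability R R) : Prop :=
  [/\ mu `[1, +oo[%classic = 1%E,
      slowly_varying l &
      forall t : R, 0 < t -> mu `]t, +oo[%classic = (l t / t `^ (tau - 1))%:E].

Record scale_free_percolation (R : realType) (d : nat) (alpha lambda : R)
    (mu : probability R R) (disp : measure_display) (T : measurableType disp)
    (P : probability T R) (W : site d -> {RV P >-> R})
    (G : T -> rel (site d)) : Prop := {
  sfp_weight_law : forall x (B : set R), measurable B -> P (W x @^-1` B) = mu B;
  sfp_weight_indep : mutually_independent W;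
  sfp_edge_measurable : forall x y, measurable [set w | G w x y];
  sfp_edge_sym : forall w, symmetric (G w);
  sfp_edge_irrefl : forall w, irreflexive (G w);
  sfp_nearest_neighbour : forall w x y, enorm R (x - y) = 1 -> G w x y;
  (* Given all the weights, the long edges are independent with the
     prescribed probabilities: joint presence over finite families factors. *)
  sfp_long_edges : forall s, long_pairs R s ->
    is_cond_prob P (sigma_generated W)
      [set w | forall e, e \in s -> G w e.1 e.2]
      (fun w => \prod_(e <- s) edge_prob lambda alpha (W^~ w) e)
}.

(* Equals +oo when x and y are not connected. *)
Definition graph_dist (R : realType) (V : Type) (e : rel V) (x y : V) : \bar R :=
  ereal_inf [set ((size p)%:R)%:E | p in [set p | path e x p /\ last x p = y]].

(* Main.v *)
(* Throughout, kappa = gamma - 1 and L = log log ||x||.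

   Upper bound. The largest weight in a box of side N is about N^(alpha/gamma),
   and vertices with the typical maximal weights of two concentric boxes of
   sides N and N^theta are adjacent as soon as theta < 1/kappa. Hence a chain of
   K ~ L / log theta hubs in boxes of sides exp (A theta^k) leads from 0 to a
   box of side ||x||, another one starts at x, and the two final hubs are
   adjacent because gamma < 2. All failures are controlled by a union bound
   over pairs of vertices, whose total is small once A is large.

   Lower bound. For theta > 1/kappa, a first-moment computation over
   self-avoiding paths shows that with high probability the k-th vertex of any
   path from a given vertex has weight at most exp (A theta^k), and, under this
   truncation, that no path of at most m steps has a last edge of length of
   order ||x|| / m, where exp (A theta^m) = ||x||^o(1). Applied at 0 and at x,
   this forbids paths of at most 2 m steps. Weights are discretised in dyadic
   classes, so that only finite products of probabilities occur, and
   1 - exp (- t) <= t^s for 0 < s <= 1 makes all sums over the lattice and over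
   the classes converge. *)
Require Import Defs.
From mathcomp Require Import all_boot all_order all_algebra.
From mathcomp Require Import all_classical all_reals all_analysis.
From mathcomp Require Import measurable_realfun ring lra zify.

Set Implicit Arguments.
Unset Strict Implicit.
Unset Printing Implicit Defensive.
Import Order.TTheory GRing.Theory Num.Theory.
Import numFieldNormedType.Exports.

Local Open Scope classical_set_scope.
Local Open Scope ring_scope.

(** * Lattice sums *)

(** Both bounds meet at kappa theta = 1 by scaling. Hubs: weights N^rho and N^(theta rho) at
    distance N^theta are adjacent when rho (1 + theta) > alpha theta, and a box of side N contains a
    weight N^rho when rho < d / (tau - 1); such a rho exists exactly when gamma theta < 1 + theta.
    Paths: an interior weight enters the bounds of two edges, hence with exponent 2 s, while
    summability over the lattice forces s > d / alpha; so 2 s > tau - 1 and the plain first moment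
    diverges. Below a truncation u, the exponent drops to some sg < tau - 1 at the price u^(2 s -
    sg). With u growing as a tower of exponent theta, the cost per step stays small when s < (sg -
    s) theta, and letting s and sg tend to d / alpha and tau - 1 turns this into kappa theta > 1.
    The constant A depends on the tolerated error but not on x: the failures of all steps are
    dominated by a geometric series that A makes small, whatever the number of steps. *)

Lemma geometric_sum_le (R : realType) (q : R) (n : nat) :
  0 <= q < 1 -> \sum_(i < n) q ^+ i <= (1 - q)^-1.
Proof.
move=> /andP[q0 q1]; have q1' : 0 < 1 - q by rewrite subr_gt0.
rewrite -(ler_pM2l q1') mulfV ?gt_eqF// -[leLHS]opprK -mulNr opprB -subrX1.
by rewrite opprB lerBlDr lerDl exprn_ge0.
Qed.

(** For nonnegative [f] this bounds the sum over the whole index type without enumerating that type,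
    so that sites, classes and pairs of them are treated alike. *)
Definition sums_below (R : realType) (I : eqType) (f : I -> R) (Q : R) :=
  forall s : seq I, uniq s -> \sum_(i <- s) f i <= Q.

Lemma sum_uniq_sub (R : realType) (I : eqType) (f : I -> R) (s t : seq I) :
  (forall i, 0 <= f i) -> uniq s -> uniq t -> {subset s <= t} ->
  \sum_(i <- s) f i <= \sum_(i <- t) f i.
Proof.
move=> f0 us ut st.
have st' : perm_eq s [seq i <- t | i \in s].
  apply: uniq_perm => //; first exact: filter_uniq.
  by move=> i; rewrite mem_filter andb_idr//; exact: st.
by rewrite (perm_big _ st') big_filter [leRHS](bigID (mem s))/= lerDl sumr_ge0.
Qed.

Lemma sums_belowM (R : realType) (I J : eqType) (f : I -> R) (g : J -> R)
    (Q Q' : R) :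
  (forall i, 0 <= f i) -> (forall j, 0 <= g j) ->
  sums_below f Q -> sums_below g Q' ->
  sums_below (fun ij : I * J => f ij.1 * g ij.2) (Q * Q').
Proof.
move=> f0 g0 fQ gQ s us.
pose s1 := undup (map fst s); pose s2 := undup (map snd s).
apply: (@le_trans _ _ (\sum_(ij <- [seq (i, j) | i <- s1, j <- s2])
    f ij.1 * g ij.2)).
  apply: sum_uniq_sub => //.
  - by move=> i; rewrite mulr_ge0.
  - by rewrite allpairs_uniq ?undup_uniq// => -[? ?] [? ?].
  - move=> [i j] ijs; apply/allpairsP; exists (i, j); rewrite !mem_undup.
    by split => //; apply/mapP; exists (i, j).
rewrite big_allpairs_dep/=; under eq_bigr do rewrite -mulr_sumr.
by rewrite -mulr_suml ler_pM ?sumr_ge0// ?fQ ?gQ ?undup_uniq.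
Qed.

Lemma sums_below_ge0 (R : realType) (I : eqType) (f : I -> R) (Q : R) :
  sums_below f Q -> 0 <= Q.
Proof. by move=> /(_ [::] isT); rewrite big_nil. Qed.

Lemma inj_sums_below (R : realType) (I J : eqType) (h : I -> J) (f : J -> R)
    (Q : R) :
  injective h -> sums_below f Q -> sums_below (f \o h) Q.
Proof.
move=> hI fQ s us; rewrite -(big_map h xpredT f).
by apply: fQ; rewrite map_inj_uniq.
Qed.

Lemma sums_below_nat (R : realType) (f : nat -> R) (Q : R) :
  (forall n, 0 <= f n) -> (forall n, \sum_(i < n) f i <= Q) -> sums_below f Q.
Proof.
move=> f0 fQ s us; apply: le_trans (fQ (\max_(i <- s) i).+1).
rewrite -(big_mkord xpredT f) sum_uniq_sub ?iota_uniq// => i si.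
by rewrite mem_index_iota ltnS (big_rem i)//= leq_maxl.
Qed.

(** Cauchy condensation: the indices from 2^K - 1 to 2^(K+1) - 2 give 2^K terms, each at most
    (2^K)^(-p), hence at most q^K in total with q = 2^(1-p) < 1. *)
Lemma p_series_bounded (R : realType) (p : R) : 1 < p ->
  exists Q, sums_below (fun n : nat => (n.+1%:R : R) `^ (- p)) Q.
Proof.
move=> p1; set f := fun n : nat => _; pose q : R := 2 `^ (1 - p).
have f0 n : 0 <= f n by exact: powR_ge0.
have q01 : 0 <= q < 1.
  rewrite powR_ge0/= /q /powR pnatr_eq0/= expR_lt1.
  by rewrite pmulr_llt0 ?ln_gt0 ?ltr1n// subr_lt0.
exists (1 - q)^-1; apply: sums_below_nat => // n.
suff H K : \sum_(0 <= i < (2 ^ K).-1) f i <= \sum_(i < K) q ^+ i.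
  apply: le_trans (geometric_sum_le n q01); apply: le_trans (H n).
  rewrite -(big_mkord xpredT f) sum_uniq_sub ?iota_uniq// => i.
  rewrite !mem_index_iota/= => /leq_trans; apply.
  by rewrite -ltnS prednK ?expn_gt0// ltn_expl.
elim: K => [|K IH]; first by rewrite expn0 big_geq// big_ord0.
have le2 : ((2 ^ K).-1 <= (2 ^ K.+1).-1)%N by rewrite expnS; lia.
rewrite (@big_cat_nat _ _ _ (2 ^ K).-1)//= big_ord_recr/= lerD//.
rewrite (_ : q ^+ K = \sum_((2 ^ K).-1 <= i < (2 ^ K.+1).-1) (2 ^+ K) `^ (- p)).
  apply: ler_sum_nat => i /andP[Ki _]; rewrite /f !powRN lef_pV2 ?posrE ?powR_gt0//.
  rewrite ge0_ler_powR ?nnegrE ?ler0n//; first by rewrite ltW// (lt_trans _ p1).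
  by rewrite -natrX ler_nat -(prednK (n := 2 ^ K)) ?expn_gt0// ltnS.
rewrite sumr_const_nat.
have -> : ((2 ^ K.+1).-1 - (2 ^ K).-1 = 2 ^ K)%N.
  by have := expn_gt0 2 K; rewrite expnS/=; lia.
rewrite -[RHS]mulr_natl natrX /q -!powR_mulrn ?ler0n// ?powR_ge0// -!powRrM.
rewrite -powRD ?pnatr_eq0 ?implybT//; congr (_ `^ _); ring.
Qed.

Lemma sums_below_int (R : realType) (f : nat -> R) (Q : R) :
  (forall n, 0 <= f n) -> sums_below f Q ->
  sums_below (fun k : int => f `|k|%N) (Q + Q).
Proof.
move=> f0 fQ s us; rewrite (bigID (fun k => 0 <= k))/= lerD//.
  rewrite -big_filter -(big_map absz xpredT f); apply: fQ.
  rewrite map_inj_in_uniq ?filter_uniq// => i j; rewrite !mem_filter; lia.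
rewrite -big_filter -(big_map absz xpredT f); apply: fQ.
rewrite map_inj_in_uniq ?filter_uniq// => i j; rewrite !mem_filter; lia.
Qed.

(** A finite set of sites is enlarged to a grid, [t] being the list of all coordinates that occur;
    on a grid the sum of products is a product of sums. *)
Lemma sums_below_rV (R : realType) (d : nat) (h : int -> R) (Q : R) :
  (forall k, 0 <= h k) -> sums_below h Q ->
  sums_below (fun x : site d => \prod_(i < d) h (x ord0 i)) (Q ^+ d).
Proof.
move=> h0 hQ s us.
pose t := undup [seq (x : site d) ord0 i | x <- s, i <- enum 'I_d].
pose r (f : {ffun 'I_d -> 'I_(size t)}) : site d := \row_i t`_(f i).
apply: (@le_trans _ _ (\sum_(x <- map r (enum {ffun 'I_d -> 'I_(size t)}))
    \prod_(i < d) h (x ord0 i))).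
  apply: sum_uniq_sub => //.
  - by move=> x; exact: prodr_ge0.
  - rewrite map_inj_uniq ?enum_uniq// => f g /rowP fg; apply/ffunP => i.
    have := fg i; rewrite !mxE => /eqP.
    by rewrite nth_uniq ?undup_uniq// => /eqP /val_inj.
  - move=> x xs; have tx i : x ord0 i \in t.
      rewrite mem_undup; apply/allpairsP; exists (x, i).
      by rewrite /= mem_enum.
    apply/mapP; have ti i : (index (x ord0 i) t < size t)%N by rewrite index_mem.
    exists [ffun i => Ordinal (ti i)]; first by rewrite mem_enum.
    by apply/rowP => i; rewrite mxE ffunE/= nth_index.
rewrite big_map big_enum/=.
under eq_bigr do under eq_bigr do rewrite mxE.
rewrite -(bigA_distr_bigA (fun _ (j : 'I_(size t)) => h t`_j))/=.
rewrite prodr_const card_ord lerXn2r ?nnegrE ?sumr_ge0 ?(sums_below_ge0 hQ)//.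
by rewrite -(big_mkord xpredT (fun j => h t`_j)) -(big_nth 0 xpredT) hQ// undup_uniq.
Qed.

Lemma coord_le_enorm (R : realType) (d : nat) (x : site d) (i : 'I_d) :
  `|x ord0 i|%:~R <= enorm R x.
Proof.
rewrite /enorm intr_norm -sqrtr_sqr ler_sqrt ?sumr_ge0//; last first.
  by move=> j _; rewrite sqr_ge0.
by rewrite (bigD1 i)//= lerDl sumr_ge0// => j _; rewrite sqr_ge0.
Qed.

Lemma enorm0 (R : realType) (d : nat) : enorm R (0 : site d) = 0.
Proof. by rewrite /enorm big1 ?sqrtr0// => i _; rewrite mxE mulr0z expr0n. Qed.

Lemma enormN (R : realType) (d : nat) (x : site d) : enorm R (- x) = enorm R x.
Proof. by congr Num.sqrt; apply: eq_bigr => i _; rewrite mxE mulrNz sqrrN. Qed.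

Lemma enorm_ge1 (R : realType) (d : nat) (x : site d) : x != 0 -> 1 <= enorm R x.
Proof.
move=> x0; have [i xi] : exists i, x ord0 i != 0.
  apply: contrapT => /forallNP H; move/eqP: x0; apply; apply/rowP => i.
  by rewrite mxE; apply/eqP/negPn/negP/H.
by apply: le_trans (coord_le_enorm R x i); rewrite ler1z; lia.
Qed.

(** For y nonzero, |y_i| + 1 <= 2 |y| for every i, so |2 y|^(-b) is at most the product of the
    (|y_i| + 1)^(-b/d): this leaves one-dimensional series with exponent b/d > 1. *)
Lemma lattice_sum_bounded (R : realType) (d : nat) (b : R) :
  (0 < d)%N -> d%:R < b ->
  exists Q, forall x : site d,
    sums_below (fun y : site d => enorm R (y - x) `^ (- b)) Q.
Proof.
move=> d0 db; have dR : 0 < d%:R :> R by rewrite ltr0n.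
have b0 : 0 < b by exact: lt_trans db.
have [Q0 HQ0] : exists Q, sums_below (fun n : nat => (n.+1%:R : R) `^ (- (b / d%:R))) Q.
  by apply: p_series_bounded; rewrite ltr_pdivlMr// mul1r.
pose h (k : int) : R := `|k|.+1%:R `^ (- (b / d%:R)).
have h0 k : 0 <= h k by exact: powR_ge0.
have hQ : sums_below h (Q0 + Q0) by apply: (sums_below_int _ HQ0) => n; exact: powR_ge0.
have PQ := @sums_below_rV R d h _ h0 hQ.
exists (2 `^ b * (Q0 + Q0) ^+ d) => x.
apply: (@inj_sums_below R _ _ (fun y => y - x) (fun y => enorm R y `^ (- b))).
  by move=> y z /addIr.
move=> s us; apply: (@le_trans _ _ (\sum_(y <- s) 2 `^ b * \prod_(i < d) h (y ord0 i))).
  apply: ler_sum => y _; have [->|y0] := eqVneq y 0.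
    (* The term at the centre vanishes, since [powR] sends base 0 with a nonzero exponent to 0. *)
    by rewrite enorm0 powR0 ?oppr_eq0 ?gt_eqF// mulr_ge0 ?powR_ge0 ?prodr_ge0.
  have y1 := enorm_ge1 R y0.
  have e0 : 0 < enorm R y by exact: lt_le_trans y1.
  rewrite -ler_pdivrMl ?powR_gt0// -powRN -powRM ?(ltW e0)//.
  have -> : (2 * enorm R y) `^ (- b) = \prod_(i < d) (2 * enorm R y) `^ (- (b / d%:R)).
    rewrite prodr_const card_ord -powR_mulrn ?powR_ge0// -powRrM mulNr.
    by rewrite divfK ?gt_eqF.
  apply: ler_prod => i _; rewrite powR_ge0/= /h !powRN lef_pV2 ?posrE ?powR_gt0//; last first.
    by rewrite mulr_gt0.
  rewrite ge0_ler_powR ?nnegrE ?divr_ge0 ?mulr_ge0 ?(ltW b0) ?(ltW e0)//.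
  have := coord_le_enorm R y i; rewrite -abszE -pmulrn -(natr1 `|_|%N); lra.
rewrite -mulr_sumr ler_pM2l ?powR_gt0//; exact: PQ.
Qed.

(** * Union bounds and conditional edge probabilities *)

Section union_bounds.
Context {disp : measure_display} {T : measurableType disp} {R : realType}.
Variable P : probability T R.

Lemma countable_union_bound (I : countType) (E : I -> set T) (f : I -> R) (Q : R) :
  (forall i, measurable (E i)) -> (forall i, 0 <= f i) ->
  (forall i, (P (E i) <= (f i)%:E)%E) -> sums_below f Q ->
  (P (\bigcup_i E i) <= Q%:E)%E.
Proof.
move=> mE f0 PE fQ.
pose F (n : nat) : set T := if pickle_inv n is Some i then E i else set0.
have mF n : measurable (F n) by rewrite /F; case: pickle_inv.
apply: (@le_trans _ _ (\sum_(n <oo) P (F n))%E).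
  apply: measure_sigma_subadditive => //.
    exact: countable_bigcupT_measurable.
  by move=> w [i _ Ei]; exists (pickle i) => //; rewrite /F pickleK_inv.
apply: lime_le; first exact: is_cvg_nneseries.
apply: nearW => N /=.
have H : (\sum_(0 <= n < N) P (F n) <=
    (\sum_(i <- pmap pickle_inv (iota 0 N)) f i)%:E)%E.
  rewrite /index_iota subn0; elim: (iota 0 N) => [|n s IH].
    by rewrite !big_nil.
  rewrite big_cons /=; rewrite {1}/F; case: pickle_inv => [i|] /=.
    by rewrite big_cons EFinD leeD.
  by rewrite measure0 add0e.
apply: le_trans H _; rewrite lee_fin; apply: fQ.
by rewrite (pmap_uniq (@pickle_invK I)) ?iota_uniq.
Qed.

Fixpoint chain_prod (I : Type) (step : I -> I -> R) (x : I) (p : seq I) : R :=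
  if p is y :: p' then step x y * chain_prod step y p' else 1.

Lemma bigcup_seq_measurable (I : countType) (E : seq I -> set T) n :
  (forall p, measurable (E p)) ->
  measurable (\bigcup_(p in [set p | size p = n]) E p).
Proof.
move=> mE; rewrite bigcup_mkcond; apply: countable_bigcupT_measurable => // p.
by case: ifP.
Qed.

(** Induction with [c] and [x] free: fixing the first vertex [y] moves [step x y] into the constant,
    and the sum over [y] then costs one factor [Q]. *)
Lemma path_union_bound (I : countType) (step : I -> I -> R) (Q : R) n :
  (forall i j, 0 <= step i j) -> (forall i, sums_below (step i) Q) ->
  forall (E : seq I -> set T) (c : R) (x : I),
  0 <= c -> (forall p, measurable (E p)) ->
  (forall p, size p = n -> (P (E p) <= (c * chain_prod step x p)%:E)%E) ->
  (P (\bigcup_(p in [set p | size p = n]) E p) <= (c * Q ^+ n)%:E)%E.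
Proof.
move=> step0 stepQ; elim: n => [|n IH] E c x c0 mE PE.
  rewrite (_ : [set p | size p = 0%N] = [set [::]]); last first.
    by apply/seteqP; split => p /=; [move/size0nil | move=> ->].
  by rewrite bigcup_set1; apply: le_trans (PE [::] _) _.
have -> : \bigcup_(p in [set p | size p = n.+1]) E p =
    \bigcup_y \bigcup_(p in [set p | size p = n]) E (y :: p).
  apply/seteqP; split => w.
    by move=> [[|y p]//= [pn] Ep]; exists y => //; exists p.
  by move=> [y _ [p /= pn Ep]]; exists (y :: p) => //=; rewrite pn.
have Q0 : 0 <= Q by exact: sums_below_ge0 (stepQ x).
apply: (@countable_union_bound _ _ (fun y => c * step x y * Q ^+ n)).
- by move=> y; exact: (bigcup_seq_measurable (E := fun p => E (y :: p))).
- by move=> y; rewrite !mulr_ge0 ?exprn_ge0.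
- move=> y; apply: (IH (fun p => E (y :: p)) _ y) => [|//|p pn].
    by rewrite mulr_ge0.
  by rewrite -mulrA; apply: PE; rewrite /= pn.
- move=> s us; rewrite -mulr_suml -mulr_sumr exprS mulrA.
  by rewrite ler_wpM2r ?exprn_ge0// ler_wpM2l// stepQ.
Qed.

End union_bounds.

(* Weights in (0, oo) are grouped into dyadic classes by their upper endpoint
   2^k. *)
Definition dyadic (R : realType) (k : nat) : set R :=
  `]2 ^+ k / 2, 2 ^+ k]%classic.
Arguments dyadic : clear implicits.

Lemma measurable_dyadic (R : realType) k : measurable (dyadic R k).
Proof. exact: measurable_itv. Qed.

Lemma minr1_powR (R : realType) (t s : R) :
  0 <= t -> 0 < s <= 1 -> Num.min 1 t <= t `^ s.
Proof.
move=> t0 /andP[s0 s1]; have [t1|t1] := leP 1 t.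
  by rewrite -(powRr0 t) ler_powR// ltW.
have [->|tn0] := eqVneq t 0; first by rewrite powR0 ?gt_eqF.
by rewrite ger1_powR// lt0r tn0 t0 ltW.
Qed.

Section path_probability.
Context {R : realType} {d : nat} {alpha lambda : R} {mu : probability R R}
  {disp : measure_display} {T : measurableType disp} {P : probability T R}
  {W : site d -> {RV P >-> R}} {G : T -> rel (site d)}.
Hypothesis sfp : scale_free_percolation alpha lambda mu W G.
Hypothesis lambda0 : 0 < lambda.

Let cylinder (s : seq (site d)) (B : site d -> set R) : set T :=
  \bigcap_(z in [set` s]) W z @^-1` B z.

Lemma cylinder_sigma s B : (forall z, measurable (B z)) ->
  sigma_generated W (cylinder s B).
Proof.
move=> mB; rewrite /sigma_generated.
set gen := [set A | _].
apply: (@fin_bigcap_measurable _ (g_sigma_algebraType gen)) => // z _.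
by apply: sub_sigma_algebra; exists z; exists (B z).
Qed.

Lemma sigma_generated_measurable A : sigma_generated W A -> measurable A.
Proof.
move: A; apply: smallest_sub; first exact: sigma_algebra_measurable.
move=> A [z [B mB ->]]; rewrite -[X in measurable X]setTI.
exact: measurable_funPT.
Qed.

Lemma cylinder_measurable s B : (forall z, measurable (B z)) ->
  measurable (cylinder s B).
Proof. by move=> mB; apply: sigma_generated_measurable; exact: cylinder_sigma. Qed.

Lemma cylinder_prob s B : uniq s -> (forall z, measurable (B z)) ->
  P (cylinder s B) = (\prod_(z <- s) mu (B z))%E.
Proof.
move=> us mB; rewrite (sfp_weight_indep sfp us mB).
by apply: eq_bigr => z _; rewrite (sfp_weight_law sfp).
Qed.

Lemma measurable_edges (s : seq (site d * site d)) :
  measurable [set w | forall e, e \in s -> G w e.1 e.2].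
Proof.
rewrite (_ : [set _ | _] = \bigcap_(e in [set` s]) [set w | G w e.1 e.2])//.
by apply: fin_bigcap_measurable => // e _; exact: (sfp_edge_measurable sfp).
Qed.

(** The cylinder belongs to the sigma-algebra of the weights, so the probability is the integral of
    the conditional one over it, and a pointwise bound there suffices. *)
Lemma edges_cylinder_le (s : seq (site d * site d)) (t : seq (site d))
    (B : site d -> set R) (K : R) : 0 <= K ->
  long_pairs R s -> (forall z, measurable (B z)) ->
  (forall w, cylinder t B w ->
    0 <= \prod_(e <- s) edge_prob lambda alpha (W^~ w) e <= K) ->
  (P ([set w | forall e, e \in s -> G w e.1 e.2] `&` cylinder t B) <=
   K%:E * P (cylinder t B))%E.
Proof.
move=> K0 ls mB fK; have [mf ->] := sfp_long_edges sfp ls; last first.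
  exact: cylinder_sigma.
have mC := cylinder_measurable t mB.
rewrite -integral_cst//; apply: ge0_le_integral => //.
- by move=> w Cw; rewrite lee_fin; case/andP: (fK w Cw).
- apply/measurable_EFinP; apply: measurable_funTS => _ A mA.
  by rewrite setTI; apply: sigma_generated_measurable; exact: mf.
- by move=> w Cw; rewrite lee_fin; case/andP: (fK w Cw).
Qed.

Lemma edges_cylinder_ge (s : seq (site d * site d)) (t : seq (site d))
    (B : site d -> set R) (K : R) : 0 <= K ->
  long_pairs R s -> (forall z, measurable (B z)) ->
  (forall w, cylinder t B w ->
    K <= \prod_(e <- s) edge_prob lambda alpha (W^~ w) e) ->
  (K%:E * P (cylinder t B) <=
   P ([set w | forall e, e \in s -> G w e.1 e.2] `&` cylinder t B))%E.
Proof.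
move=> K0 ls mB fK; have [mf ->] := sfp_long_edges sfp ls; last first.
  exact: cylinder_sigma.
have mC := cylinder_measurable t mB.
rewrite -integral_cst//; apply: ge0_le_integral => //.
apply/measurable_EFinP; apply: measurable_funTS => _ A mA.
by rewrite setTI; apply: sigma_generated_measurable; exact: mf.
Qed.

End path_probability.

(** * Probability of a path with prescribed weight classes *)

Lemma zip_path_mem (V : eqType) (x : V) (q : seq V) (e : V * V) :
  e \in zip (x :: q) q -> (e.1 \in x :: q) && (e.2 \in q).
Proof.
elim: q x => [//|y q IH] x; rewrite /= inE => /predU1P[->|/IH].
  by rewrite !inE !eqxx.
by rewrite !inE => /andP[/orP[->|->] ->]; rewrite !orbT.
Qed.

(** Self-avoidance enters here: the edges are distinct even as unordered pairs, as [long_pairs]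
    requires, so their conditional probabilities multiply. *)
Lemma zip_path_uniq (V : eqType) (x : V) (q : seq V) :
  uniq (x :: q) -> uniq (zip (x :: q) q) /\
  forall e, e \in zip (x :: q) q -> (e.2, e.1) \notin zip (x :: q) q.
Proof.
elim: q x => [//|y q IH] x /=.
rewrite inE negb_or => /andP[/andP[xy xq] uq].
have [uz rz] := IH y uq.
have xz b c : (x, b) \notin zip (y :: q) q /\ (c, x) \notin zip (y :: q) q.
  split; apply/negP => /zip_path_mem/=; rewrite inE => /andP[].
    by rewrite (negbTE xy) (negbTE xq).
  by rewrite (negbTE xq).
split; first by rewrite (proj1 (xz y y)).
move=> [a b]; rewrite !inE => /predU1P[[-> ->]|abz].
  rewrite negb_or (proj2 (xz y y)) andbT /=.
  by apply: contraNneq xy => -[->].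
rewrite negb_or rz// andbT; apply: contraTneq abz => -[-> ->].
exact: (proj2 (xz y y)).
Qed.

Lemma path_zip (V : eqType) (e : rel V) (x : V) (q : seq V) :
  path e x q -> forall f, f \in zip (x :: q) q -> e f.1 f.2.
Proof.
elim: q x => [//|y q IH] x /= /andP[exy eyq] f.
by rewrite inE => /predU1P[->//|]; exact: IH.
Qed.

Lemma long_pairs_path (R : realType) d (x : site d) (q : seq (site d)) :
  uniq (x :: q) ->
  long_pairs R [seq e <- zip (x :: q) q | 1 < enorm R (e.1 - e.2)].
Proof.
move=> /zip_path_uniq[uz rz]; split; first exact: filter_uniq.
move=> e; rewrite mem_filter => /andP[-> ez]; split => //.
by rewrite mem_filter negb_and rz// orbT.
Qed.

Lemma enormB (R : realType) (d : nat) (x y : site d) :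
  enorm R (x - y) = enorm R (y - x).
Proof. by rewrite -opprB enormN. Qed.

Lemma edge_prob_le (R : realType) (d : nat) (alpha lambda s v v' : R)
    (w : site d -> R) (x y : site d) :
  0 < lambda -> 0 < s <= 1 -> 0 < enorm R (x - y) ->
  0 < w x <= v -> 0 < w y <= v' ->
  0 <= edge_prob lambda alpha w (x, y) <=
    lambda `^ s * (v * v') `^ s * enorm R (x - y) `^ (- (alpha * s)).
Proof.
move=> l0 s01 e0 /andP[x0 xv] /andP[y0 yv].
have v0 : 0 < v by exact: lt_le_trans xv.
have v'0 : 0 < v' by exact: lt_le_trans yv.
have s0 : 0 <= s by case/andP: s01 => /ltW.
rewrite /edge_prob/=; set t := _ / _.
have ea : 0 < enorm R (x - y) `^ alpha by rewrite powR_gt0.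
have t0 : 0 <= t by rewrite /t divr_ge0 ?mulr_ge0 ?ltW.
rewrite subr_ge0 expR_le1 oppr_le0 t0/=.
have tv : t <= lambda * (v * v') / enorm R (x - y) `^ alpha.
  rewrite /t ler_pM2r ?invr_gt0// -mulrA ler_pM2l// ler_pM ?(ltW x0) ?(ltW y0)//.
apply: (@le_trans _ _ (Num.min 1 t)).
  rewrite le_min gerBl expR_ge0/= lerBlDl addrC -lerBlDr.
  by have := expR_ge1Dx (- t); lra.
apply: le_trans (minr1_powR t0 s01) _.
apply: (@le_trans _ _ ((lambda * (v * v') / enorm R (x - y) `^ alpha) `^ s)).
  rewrite ge0_ler_powR ?nnegrE//.
  by rewrite divr_ge0 ?mulr_ge0 ?(ltW l0) ?(ltW v0) ?(ltW v'0) ?(ltW ea).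
rewrite -powRN powRM ?powR_ge0 ?mulr_ge0 ?(ltW l0) ?(ltW v0) ?(ltW v'0)//.
rewrite powRM ?mulr_ge0 ?(ltW l0) ?(ltW v0) ?(ltW v'0)//.
by rewrite -powRrM mulNr.
Qed.

Section path_cost.
Context {R : realType} {d : nat}.
Variables (alpha lambda s : R) (mu : probability R R).

(** [v] bounds the weight of the current vertex. The factor 1 + lambda^s serves both kinds of edges:
    it dominates the lambda^s of a long edge, and it is at least 1 for a nearest-neighbour edge,
    which is always present. *)
Fixpoint path_cost (v : R) (x : site d) (p : seq (site d * nat)) : R :=
  if p is (y, k) :: p' then
    (1 + lambda `^ s) * (v * 2 ^+ k) `^ s * enorm R (y - x) `^ (- (alpha * s)) *
      fine (mu (dyadic R k)) * path_cost (2 ^+ k) y p'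
  else 1.

(** The part of [path_cost] that bounds the conditional probability of the edges given the
    weights. *)
Fixpoint path_kernel (v : R) (x : site d) (p : seq (site d * nat)) : R :=
  if p is (y, k) :: p' then
    (1 + lambda `^ s) * (v * 2 ^+ k) `^ s * enorm R (y - x) `^ (- (alpha * s)) *
      path_kernel (2 ^+ k) y p'
  else 1.

Lemma path_cost_kernel v x p :
  path_cost v x p = path_kernel v x p * \prod_(e <- p) fine (mu (dyadic R e.2)).
Proof.
elim: p v x => [|[y k] p IH] v x /=; first by rewrite big_nil mulr1.
by rewrite big_cons IH/=; ring.
Qed.

Lemma path_kernel_ge0 v x p : 0 <= path_kernel v x p.
Proof.
by elim: p v x => //= -[y k] p IH v x; rewrite !mulr_ge0 ?addr_ge0 ?powR_ge0.
Qed.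

Context {disp : measure_display} {T : measurableType disp} {P : probability T R}
  {W : site d -> {RV P >-> R}} {G : T -> rel (site d)}.
Hypothesis sfp : scale_free_percolation alpha lambda mu W G.
Hypothesis lambda0 : 0 < lambda.
Hypothesis s01 : 0 < s <= 1.

Definition path_event (u : R) (x : site d) (p : seq (site d * nat)) : set T :=
  [set w | path (G w) x (map fst p)] `&`
  ([set w | 0 < W x w <= u] `&`
   [set w | forall e, e \in p -> W e.1 w \in dyadic R e.2]).

Lemma path_measurable x q : measurable [set w | path (G w) x q].
Proof.
elim: q x => [|y q IH] x /=; first by rewrite (_ : [set _ | _] = setT)//; apply/seteqP.
rewrite (_ : [set _ | _] = [set w | G w x y] `&` [set w | path (G w) y q]).
  by apply: measurableI => //; exact: (sfp_edge_measurable sfp).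
by apply/seteqP; split => w /= => [/andP|[-> ->]].
Qed.

Lemma path_event_measurable u x p : measurable (path_event u x p).
Proof.
apply: measurableI; first exact: path_measurable.
apply: measurableI.
  rewrite (_ : [set _ | _] = W x @^-1` `]0, u]).
    by rewrite -[X in measurable X]setTI; exact: measurable_funPT.
  by apply/seteqP; split => w /=; rewrite in_itv.
rewrite (_ : [set _ | _] = \bigcap_(e in [set` p]) (W e.1 @^-1` dyadic R e.2)).
  apply: fin_bigcap_measurable => // e _.
  rewrite -[X in measurable X]setTI; apply: measurable_funPT => //.
  exact: measurable_dyadic.
by apply/seteqP; split => w H e /H; rewrite inE.
Qed.

(** As the vertices of a path are distinct, [index] recovers the class attached to a vertex; the
    value off the path is a default that the cylinder never consults. *)
Let classes (u : R) (x : site d) (p : seq (site d * nat)) (z : site d) : set R :=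
  if z == x then `]0, u]%classic
  else dyadic R (nth 0%N (map snd p) (index z (map fst p))).

Lemma path_edge_prob_le v x p (w : site d -> R) :
  1 <= v -> uniq (x :: map fst p) -> 0 < w x <= v ->
  (forall e, e \in p -> w e.1 \in dyadic R e.2) ->
  0 <= \prod_(e <- zip (x :: map fst p) (map fst p) | 1 < enorm R (e.1 - e.2))
    edge_prob lambda alpha w e <= path_kernel v x p.
Proof.
elim: p v x => [|[y k] p IH] v x v1 /=; first by rewrite big_nil ler01 lexx.
rewrite inE negb_or => /andP[/andP[xy _] up] xv wp.
have wy : 0 < w y <= 2 ^+ k.
  have := wp (y, k) (mem_head _ _); rewrite inE/= /dyadic/= in_itv/=.
  by move=> /andP[/(lt_trans _)->//]; rewrite divr_gt0 ?exprn_gt0.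
have k1 : 1 <= 2 ^+ k :> R by rewrite exprn_ege1 ?ler1n.
have wp' e : e \in p -> w e.1 \in dyadic R e.2.
  by move=> ep; apply: wp; rewrite inE ep orbT.
have {IH} /andP[IH0 IHk] := IH (2 ^+ k) y k1 up wy wp'.
have e1 : 1 <= enorm R (x - y) by rewrite enorm_ge1// subr_eq0.
have e0 : 0 < enorm R (x - y) by exact: lt_le_trans e1.
have L1 : 1 <= 1 + lambda `^ s by rewrite lerDl powR_ge0.
have pv1 : 1 <= (v * 2 ^+ k) `^ s.
  rewrite -[leLHS](powRr0 (v * 2 ^+ k)) ler_powR//; last by case/andP: s01 => /ltW.
  by rewrite mulr_ege1.
rewrite big_cons/= enormB in e1 e0 *; case: ifPn => [_|].
  have := edge_prob_le alpha lambda0 s01 _ xv wy.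
  rewrite enormB => /(_ e0) /andP[H0 H1].
  rewrite mulr_ge0//= ler_pM// (le_trans H1)//.
  by rewrite !ler_wpM2r ?powR_ge0// lerDr.
(* A step of norm 1 gives no factor on the left; on the right its factor is at least 1 because [v]
   and 2^k are. *)
rewrite -leNgt => e1'; have -> : enorm R (y - x) = 1 by apply/eqP; rewrite eq_le e1 e1'.
rewrite IH0 powR1 mulr1/=; apply: le_trans IHk _.
by rewrite ler_peMl ?path_kernel_ge0// mulr_ege1.
Qed.

Lemma path_event_prob u x p : 1 <= u -> uniq (x :: map fst p) ->
  (P (path_event u x p) <= (path_cost u x p)%:E)%E.
Proof.
move=> u1 up; have /andP[xp up'] : (x \notin map fst p) && uniq (map fst p) by [].
have mB z : measurable (classes u x p z).
  by rewrite /classes; case: ifP => _; [exact: measurable_itv|exact: measurable_dyadic].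
pose es := [seq e <- zip (x :: map fst p) (map fst p) | 1 < enorm R (e.1 - e.2)].
have cp e : e \in p -> classes u x p e.1 = dyadic R e.2.
  move=> ep; rewrite /classes ifF; last first.
    by apply/eqP => ex; move: xp; rewrite -ex map_f.
  congr dyadic; have ip : (index e p < size p)%N by rewrite index_mem.
  rewrite -{2}(nth_index e ep) -(nth_map _ 0%N)//; congr nth.
  rewrite -{1}(nth_index e ep) -(nth_map _ e.1)// index_uniq ?size_map//.
pose C := \bigcap_(z in [set` x :: map fst p]) W z @^-1` classes u x p z.
have CE w : C w <-> 0 < W x w <= u /\ forall e, e \in p -> W e.1 w \in dyadic R e.2.
  split=> [Cw|[xu H] z /=].
    split=> [|e ep]; first by have := Cw x; rewrite /= inE eqxx /classes eqxx/= in_itv/=; exact.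
    rewrite -(cp e ep) inE; apply: Cw; rewrite /= inE; apply/orP; right.
    by rewrite map_f.
  rewrite inE => /predU1P[->|/mapP[e ep ->]]; first by rewrite /classes eqxx/= in_itv.
  by rewrite cp//; have := H e ep; rewrite inE.
apply: (@le_trans _ _ (P ([set w | forall e, e \in es -> G w e.1 e.2] `&` C))).
  apply: le_measure; rewrite ?inE.
  - exact: path_event_measurable.
  - by apply: measurableI; [exact: (measurable_edges sfp)|exact: cylinder_measurable].
  - move=> w [pw [xu H]]; split; last by apply/CE.
    by move=> e; rewrite mem_filter => /andP[_]; exact: path_zip pw e.
apply: le_trans.
  apply: (edges_cylinder_le sfp (K := path_kernel u x p)) => //.
  - by rewrite path_kernel_ge0.
  - exact: long_pairs_path.
  - move=> w /CE[xu H]; rewrite big_filter.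
    exact: (path_edge_prob_le (w := W^~ w)).
rewrite path_cost_kernel EFinM lee_wpmul2l ?lee_fin ?path_kernel_ge0//.
rewrite (cylinder_prob sfp)// big_cons big_map.
rewrite (_ : (\prod_(j <- p) mu (classes u x p j.1))%E =
  (\prod_(e <- p) fine (mu (dyadic R e.2)))%:E).
  (* The weight of the starting vertex is only truncated, so its probability is bounded by 1. *)
  apply: le_trans (lee_wpmul2r _ (probability_le1 mu (mB x))) _.
    by rewrite lee_fin prodr_ge0// => e _; rewrite fine_ge0.
  by rewrite mul1e.
rewrite -prodEFin; apply: eq_big_seq => e ep; rewrite cp// fineK//.
by rewrite fin_num_measure//; exact: measurable_dyadic.
Qed.

End path_cost.

(** * Truncated first moment *)

Section truncated_paths.
Context {R : realType} {d : nat}.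
Variables (alpha lambda s sg b' : R) (mu : probability R R).
Variables (u : nat -> R) (D : R).
Hypotheses (lambda0 : 0 < lambda) (s01 : 0 < s <= 1) (s_le_sg : s <= sg)
  (sg_le_2s : sg <= s + s) (b'_le : b' <= alpha * s).
Hypotheses (u_ge1 : forall j, 1 <= u j)
  (uD : forall j, u j `^ s * u j.+1 `^ (s - sg) <= D).

Let L := 1 + lambda `^ s.

(** Designed to be summable over all pairs of a site and a class: [b'] will exceed [d], and [sg]
    will lie below [tau - 1]. *)
Definition path_step (e f : site d * nat) : R :=
  enorm R (f.1 - e.1) `^ (- b') * ((2 ^+ f.2) `^ sg * fine (mu (dyadic R f.2))).

Lemma path_step_ge0 e f : 0 <= path_step e f.
Proof. by rewrite !mulr_ge0 ?powR_ge0// fine_ge0. Qed.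

(** The truncation is imposed on interior vertices only, those whose weight enters two edges; [j]
    counts the steps already made. *)
Fixpoint first_stop (stop : nat -> site d -> site d * nat -> bool) (j : nat)
    (x : site d) (p : seq (site d * nat)) : bool :=
  match p with
  | [::] => false
  | [:: e] => stop j.+1 x e
  | e :: p' => (2 ^+ e.2 <= u j.+1) && first_stop stop j.+1 e.1 p'
  end.

(* The factor (v / u j) ^ s is the potential making the induction work: one
   step costs (u j) ^ s * (u j.+1) ^ (s - sg) <= D. *)
Lemma path_cost_le (stop : nat -> site d -> site d * nat -> bool) (F : R) (n : nat) : 0 <= F ->
  (forall (x y : site d) k, x != y -> stop n x (y, k) ->
    (2 ^+ k) `^ s * enorm R (y - x) `^ (- (alpha * s)) <=
    F * u n `^ (s - sg) * (2 ^+ k) `^ sg * enorm R (y - x) `^ (- b')) ->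
  forall p j v (x : site d) (k0 : nat), 0 < v <= u j -> uniq (x :: map fst p) ->
  (j + size p = n)%N -> first_stop stop j x p ->
  path_cost alpha lambda s mu v x p <=
  F * (v `^ s / u j `^ s) * (L * D) ^+ size p * chain_prod path_step (x, k0) p.
Proof.
move=> F0 stopF; have s0 : 0 <= s by case/andP: s01 => /ltW.
have L0 : 0 <= L by rewrite addr_ge0 ?powR_ge0.
have u0 j : 0 < u j by exact: lt_le_trans (u_ge1 j).
have us0 j t : 0 < u j `^ t by rewrite powR_gt0.
have m0 k : 0 <= fine (mu (dyadic R k)) by rewrite fine_ge0.
have V0 k : 0 <= 2 ^+ k :> R by rewrite exprn_ge0.
have stepD j : u j.+1 `^ (s - sg) <= D / u j `^ s.
  by rewrite ler_pdivlMr// mulrC.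
elim=> [//|[y k] p IH] j v x k0 /andP[v0 vu] ux jn.
have vs0 : 0 <= v `^ s by exact: powR_ge0.
have D0 : 0 <= D by apply: le_trans (uD j); rewrite mulr_ge0 ?powR_ge0.
have xy : x != y by move: ux; rewrite /= inE negb_or -andbA => /and3P[].
have e1 : 1 <= enorm R (y - x) by rewrite enorm_ge1// subr_eq0 eq_sym.
have Ege0 t : 0 <= enorm R (y - x) `^ t by exact: powR_ge0.
rewrite [path_cost _ _ _ _ _ _ _]/= powRM ?(ltW v0)//.
case: p IH ux jn => [_ _ jn stp|f p IH ux jn].
  have {stp} : stop n x (y, k) by rewrite -jn addn1.
  move/(stopF _ _ _ xy) => H.
  have -> : (1 + lambda `^ s) * (v `^ s * (2 ^+ k) `^ s) *
      enorm R (y - x) `^ (- (alpha * s)) * fine (mu (dyadic R k)) *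
      path_cost alpha lambda s mu (2 ^+ k) y [::] =
    (L * v `^ s * fine (mu (dyadic R k))) *
      ((2 ^+ k) `^ s * enorm R (y - x) `^ (- (alpha * s))).
    by rewrite /= /L; ring.
  have Lvm : 0 <= L * v `^ s * fine (mu (dyadic R k)) by rewrite !mulr_ge0.
  apply: le_trans (ler_wpM2l Lvm H) _.
  have := stepD j; rewrite -jn addn1 => /(ler_wpM2l Lvm) H'.
  have G0 : 0 <= F * (2 ^+ k) `^ sg * enorm R (y - x) `^ (- b').
    by rewrite !mulr_ge0 ?powR_ge0.
  have := ler_wpM2r G0 H'; rewrite /path_step/= expr1; apply: etrans.
  by congr (_ <= _); ring.
move=> /andP[Vu fs].
have uy : uniq (y :: map fst (f :: p)) by move: ux; rewrite cons_uniq => /andP[].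
have := IH j.+1 (2 ^+ k) y k _ uy _ fs.
rewrite exprn_gt0// => /(_ Vu); rewrite addSnnS => /(_ jn) {}IH.
rewrite [chain_prod _ _ _]/= -/(chain_prod path_step (y, k) (f :: p)).
set C := path_cost _ _ _ _ _ _ _ in IH *.
set Pi := chain_prod _ _ _ in IH *.
have Pi0 : 0 <= Pi.
  rewrite /Pi; elim: (f :: p) (y, k) => [|e q IHq] e'/=; first exact: ler01.
  by rewrite mulr_ge0 ?path_step_ge0.
have K1 : 0 <= L * v `^ s * (2 ^+ k) `^ s * fine (mu (dyadic R k)).
  by rewrite !mulr_ge0 ?powR_ge0.
have HE : enorm R (y - x) `^ (- (alpha * s)) <= enorm R (y - x) `^ (- b').
  by rewrite ler_powR// lerN2.
(* For V = 2^k <= u j.+1 and sg <= 2 s, V^(2 s) is at most (u j.+1)^(2 s - sg) V^sg; the potential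
   of the remaining path divides this by (u j.+1)^s. *)
have HV : (2 ^+ k) `^ s * (2 ^+ k) `^ s / u j.+1 `^ s <=
    D / u j `^ s * (2 ^+ k) `^ sg.
  have Vn0 : 2 ^+ k != 0 :> R by rewrite expf_neq0.
  have un0 : u j.+1 != 0 by rewrite gt_eqF.
  apply: (@le_trans _ _ (u j.+1 `^ (s - sg) * (2 ^+ k) `^ sg)); last first.
    by rewrite ler_wpM2r ?powR_ge0.
  rewrite ler_pdivrMr//.
  have -> : u j.+1 `^ (s - sg) * (2 ^+ k) `^ sg * u j.+1 `^ s =
    (2 ^+ k) `^ sg * (u j.+1 `^ s * u j.+1 `^ (s - sg)) by ring.
  rewrite -!powRD ?Vn0 ?un0 ?implybT//.
  have -> : s + s = sg + (s + s - sg) by ring.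
  rewrite powRD ?Vn0 ?un0 ?implybT// ler_wpM2l ?powR_ge0//.
  have -> : s + (s - sg) = s + s - sg by ring.
  by rewrite ge0_ler_powR ?nnegrE ?subr_ge0// ltW.
apply: (@le_trans _ _ (L * (v `^ s * (2 ^+ k) `^ s) * enorm R (y - x) `^ (- (alpha * s)) *
    fine (mu (dyadic R k)) * (F * ((2 ^+ k) `^ s / u j.+1 `^ s) *
    (L * D) ^+ size (f :: p) * Pi))).
  by rewrite ler_wpM2l// !mulr_ge0 ?powR_ge0.
have -> : size [:: (y, k), f & p] = (size (f :: p)).+1 by [].
rewrite exprS.
have A0 : 0 <= L * v `^ s * fine (mu (dyadic R k)) * F * (L * D) ^+ size (f :: p) * Pi.
  have LDn : 0 <= (L * D) ^+ size (f :: p) by rewrite exprn_ge0 ?mulr_ge0.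
  by do 5![apply: mulr_ge0 => //].
have A1 : (2 ^+ k) `^ s * (2 ^+ k) `^ s / u j.+1 `^ s * enorm R (y - x) `^ (- (alpha * s)) <=
    D / u j `^ s * (2 ^+ k) `^ sg * enorm R (y - x) `^ (- b').
  by rewrite ler_pM// !mulr_ge0 ?invr_ge0 ?powR_ge0.
have := ler_wpM2l A0 A1; rewrite /path_step/=; apply: etrans.
by congr (_ <= _); ring.
Qed.

End truncated_paths.

Lemma ler_powR_neg (R : realType) (t a b : R) :
  t <= 0 -> 0 < a -> a <= b -> b `^ t <= a `^ t.
Proof.
move=> t0 a0 ab; have b0 : 0 < b by exact: lt_le_trans ab.
rewrite -(opprK t) !(powRN _ (- t)) lef_pV2 ?posrE ?powR_gt0//.
by rewrite ge0_ler_powR ?nnegrE ?oppr_ge0 ?(ltW a0) ?(ltW b0).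
Qed.

(** * Stopping at a heavy vertex or at a long edge *)

Section stopping.
Context {R : realType} {d : nat}.
Variables (u : nat -> R) (r : R).

Definition stop_heavy (n : nat) (x : site d) (e : site d * nat) : bool :=
  u n < 2 ^+ e.2.

Definition stop_long (n : nat) (x : site d) (e : site d * nat) : bool :=
  (2 ^+ e.2 <= u n) && (r <= enorm R (e.1 - x)).

(** If some weight exceeds its truncation, cut the path at the first such vertex; otherwise the
    whole path ends with its long edge. *)
Lemma first_stop_exists (c : site d -> nat) q z x j :
  r <= enorm R (z - last x q) ->
  exists2 n, (n <= size q)%N &
    let p := [seq (y, c y) | y <- take n.+1 (rcons q z)] in
    first_stop u stop_heavy j x p || first_stop u stop_long j x p.
Proof.
elim: q x j => [|y q IH] x j /= rz.
  exists 0%N => //=; rewrite /stop_heavy /stop_long/= rz andbT.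
  by case: leP.
have [uy|uy] := ltP (u j.+1) (2 ^+ c y).
  by exists 0%N => //=; rewrite take0 /= /stop_heavy uy.
have [n nq H] := IH y j.+1 rz; exists n.+1 => //.
by move: H => /=; case: (take n.+1 _).
Qed.

End stopping.

Lemma finite_union_bound {disp : measure_display} {T : measurableType disp}
    {R : realType} (P : probability T R) (m : nat) (E : nat -> set T) (f : nat -> R) :
  (forall i, measurable (E i)) -> (forall i, 0 <= f i) ->
  (forall i, (i < m)%N -> (P (E i) <= (f i)%:E)%E) ->
  (P (\bigcup_(i < m) E i) <= (\sum_(i < m) f i)%:E)%E.
Proof.
move=> mE f0 PE.
have -> : \bigcup_(i < m) E i = \bigcup_(i : 'I_m) E i.
  apply/seteqP; split => w; first by move=> [i im Ei]; exists (Ordinal im).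
  by move=> [i _ Ei]; exists i => //=.
apply: (@countable_union_bound _ _ _ P _ (fun i : 'I_m => E i) (fun i => f i)) => //.
  by move=> i; exact: PE.
move=> s us; rewrite -big_enum/=; apply: sum_uniq_sub => //.
  exact: enum_uniq.
by move=> i _; rewrite mem_enum.
Qed.

Section no_long_edge.
Context {R : realType} {d : nat}.
Variables (alpha lambda s sg b' : R) (mu : probability R R).
Context {disp : measure_display} {T : measurableType disp} {P : probability T R}
  {W : site d -> {RV P >-> R}} {G : T -> rel (site d)}.
Hypothesis sfp : scale_free_percolation alpha lambda mu W G.
Hypothesis mu_ge1 : mu `[1, +oo[%classic = 1%E.
Variables (u : nat -> R) (D S M : R).
Hypotheses (lambda0 : 0 < lambda) (s01 : 0 < s <= 1) (s_le_sg : s <= sg)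
  (sg_le_2s : sg <= s + s) (b'_le : b' <= alpha * s).
Hypotheses (u_ge1 : forall j, 1 <= u j)
  (u_mono : {homo u : i j / (i <= j)%N >-> i <= j})
  (uD : forall j, u j `^ s * u j.+1 `^ (s - sg) <= D).
Hypotheses (sumS : forall x : site d,
    sums_below (fun y : site d => enorm R (y - x) `^ (- b')) S)
  (sumM : sums_below (fun k => (2 ^+ k) `^ sg * fine (mu (dyadic R k))) M).

Let L := 1 + lambda `^ s.

(** Discarding this null set gives every weight a class, since the sets [dyadic R k] cover only the
    reals above 1/2. *)
Lemma light_weights_null : exists U : set T,
  [/\ measurable U, P U = 0%E & forall w, ~ U w -> forall z, 1 <= W z w].
Proof.
pose E (z : site d) := W z @^-1` (~` `[1, +oo[).
have mE z : measurable (E z).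
  rewrite -[X in measurable X]setTI; apply: measurable_funPT => //.
  by apply: measurableC; exact: measurable_itv.
exists (\bigcup_z E z); split.
- exact: countable_bigcupT_measurable.
- apply/eqP; rewrite eq_le measure_ge0 andbT.
  apply: (@countable_union_bound _ _ _ P _ E (fun _ => 0)) => //.
    move=> z; rewrite /E (sfp_weight_law sfp); last first.
      by apply: measurableC; exact: measurable_itv.
    by rewrite probability_setC ?mu_ge1 ?subee//; exact: measurable_itv.
  by move=> t _; rewrite big1.
- move=> w Uw z; apply: contrapT => Wz; apply: Uw; exists z => //.
  by rewrite /E /preimage /setC /= in_itv/= andbT.
Qed.

Let stopped_paths (stop : nat -> site d -> site d * nat -> bool) x n : set T :=
  \bigcup_(p in [set p | size p = n])
    (if uniq (x :: map fst p) && first_stop u stop 0 x p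
     then path_event (W := W) (G := G) (u 0%N) x p else set0).

Lemma stopped_paths_measurable (stop : nat -> site d -> site d * nat -> bool) x n :
  measurable (stopped_paths stop x n).
Proof.
apply: bigcup_seq_measurable => p; case: ifP => _ //.
exact: path_event_measurable sfp _ _ _.
Qed.

Lemma stopped_paths_prob (stop : nat -> site d -> site d * nat -> bool)
    (F : R) (x : site d) n : 0 <= F ->
  (forall (x y : site d) k, x != y -> stop n x (y, k) ->
    (2 ^+ k) `^ s * enorm R (y - x) `^ (- (alpha * s)) <=
    F * u n `^ (s - sg) * (2 ^+ k) `^ sg * enorm R (y - x) `^ (- b')) ->
  (P (stopped_paths stop x n) <= (F * (L * D * (S * M)) ^+ n)%:E)%E.
Proof.
move=> F0 stopF.
have D0 : 0 <= D by apply: le_trans (uD 0%N); rewrite mulr_ge0 ?powR_ge0.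
have L0 : 0 <= L by rewrite addr_ge0 ?powR_ge0.
rewrite exprMn mulrA.
apply: (@path_union_bound _ _ _ P _ (path_step sg b' mu) (S * M) n _ _ _ _ (x, 0%N)).
- by move=> i j; exact: path_step_ge0.
- move=> i; apply: (@sums_belowM _ _ _
    (fun y => enorm R (y - i.1) `^ (- b'))
    (fun k => (2 ^+ k) `^ sg * fine (mu (dyadic R k)))) => //.
    by move=> y; exact: powR_ge0.
  by move=> k; rewrite mulr_ge0 ?powR_ge0// fine_ge0.
- by rewrite mulr_ge0// exprn_ge0// mulr_ge0.
- by move=> p; case: ifP => _ //; exact: path_event_measurable sfp _ _ _.
- move=> p pn; case: ifPn => [/andP[up fs]|_]; last first.
    rewrite measure0 lee_fin mulr_ge0//.
      by rewrite mulr_ge0// exprn_ge0// mulr_ge0.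
    elim: (p) (x, 0%N) => [|e q IHq] e'/=; first exact: ler01.
    by rewrite mulr_ge0 ?path_step_ge0.
  apply: le_trans (path_event_prob sfp lambda0 s01 (u_ge1 0) up) _.
  rewrite lee_fin.
  have u00 : 0 < u 0%N <= u 0%N by rewrite (lt_le_trans _ (u_ge1 0))/=.
  have := path_cost_le lambda mu s01 sg_le_2s b'_le u_ge1 uD F0 stopF
    0%N u00 up _ fs.
  rewrite add0n pn divff ?mulr1; first by apply.
  by rewrite powR_eq0 negb_and gt_eqF// (lt_le_trans _ (u_ge1 0)).
Qed.

(** A weight V > u n pays for itself: V^(s - sg) <= (u n)^(s - sg) because s <= sg. Hence F = 1 in
    this case. *)
Lemma stop_heavy_cost (x y : site d) k n : x != y -> stop_heavy u n x (y, k) ->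
  (2 ^+ k) `^ s * enorm R (y - x) `^ (- (alpha * s)) <=
    1 * u n `^ (s - sg) * (2 ^+ k) `^ sg * enorm R (y - x) `^ (- b').
Proof.
move=> xy /ltW uk; rewrite mul1r.
have e1 : 1 <= enorm R (y - x) by rewrite enorm_ge1// subr_eq0 eq_sym.
rewrite ler_pM ?powR_ge0//; last by rewrite ler_powR// lerN2.
have -> : (2 ^+ k) `^ s = (2 ^+ k) `^ (s - sg) * (2 ^+ k) `^ sg :> R.
  by rewrite -powRD ?expf_neq0 ?implybT// subrK.
rewrite ler_wpM2r ?powR_ge0//.
by rewrite ler_powR_neg ?subr_le0// (lt_le_trans _ (u_ge1 n)).
Qed.

(** The surplus alpha s - b' in the exponent of the long edge yields the power of [r], and (u m)^(sg
    - s) offsets (u n)^(s - sg) for all n <= m at once. *)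
Lemma stop_long_cost (x y : site d) k n m r : 0 < r -> (n <= m)%N ->
  x != y -> stop_long u r n x (y, k) ->
  (2 ^+ k) `^ s * enorm R (y - x) `^ (- (alpha * s)) <=
    (u m `^ (sg - s) * r `^ (b' - alpha * s)) *
    u n `^ (s - sg) * (2 ^+ k) `^ sg * enorm R (y - x) `^ (- b').
Proof.
move=> r0 nm xy /andP[/= uk re].
have e1 : 1 <= enorm R (y - x) by rewrite enorm_ge1// subr_eq0 eq_sym.
have e0 : 0 < enorm R (y - x) by exact: lt_le_trans e1.
have -> : enorm R (y - x) `^ (- (alpha * s)) =
    enorm R (y - x) `^ (b' - alpha * s) * enorm R (y - x) `^ (- b').
  by rewrite -powRD ?(gt_eqF e0) ?implybT//; congr (_ `^ _); ring.
have H1 : 1 <= u m `^ (sg - s) * u n `^ (s - sg).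
  rewrite -(opprB sg s) powRN ler_pdivlMr ?mul1r ?powR_gt0 ?(lt_le_trans _ (u_ge1 n))//.
  by rewrite ge0_ler_powR ?nnegrE ?subr_ge0 ?u_mono// (le_trans ler01).
have H2 : (2 ^+ k) `^ s <= (2 ^+ k) `^ sg :> R by rewrite ler_powR// exprn_ege1// ler1n.
have H3 : enorm R (y - x) `^ (b' - alpha * s) <= r `^ (b' - alpha * s).
  by rewrite ler_powR_neg// subr_le0.
have H4 : (2 ^+ k) `^ s * enorm R (y - x) `^ (b' - alpha * s) <=
    (u m `^ (sg - s) * u n `^ (s - sg)) * ((2 ^+ k) `^ sg * r `^ (b' - alpha * s)).
  rewrite -[leLHS]mul1r ler_pM ?mulr_ge0 ?powR_ge0// ler_pM ?powR_ge0//.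
have := ler_wpM2r (powR_ge0 (enorm R (y - x)) (- b')) H4.
set a := (2 ^+ k) `^ s; set c := enorm R (y - x) `^ (b' - _).
set e := enorm R (y - x) `^ (- b'); set v := u m `^ _; set v' := u n `^ _.
set f := (2 ^+ k) `^ sg; set g := r `^ _; apply: etrans.
by congr (_ <= _); ring.
Qed.

Lemma no_long_edge x m r : 0 < r -> L * D * (S * M) <= 2^-1 ->
  exists U : set T, [/\ measurable U,
    (P U <= mu `]u 0%N, +oo[%classic +
      (2 * (L * D * (S * M)) * (1 + u m `^ (sg - s) * r `^ (b' - alpha * s)))%:E)%E &
    forall w, ~ U w -> forall q z, (size q < m)%N -> uniq (x :: rcons q z) ->
      path (G w) x (rcons q z) -> enorm R (z - last x q) < r].
Proof.
move=> r0; set q0 := L * D * (S * M) => q0_le.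
have D0 : 0 <= D by apply: le_trans (uD 0%N); rewrite mulr_ge0 ?powR_ge0.
have q0_ge0 : 0 <= q0.
  by rewrite !mulr_ge0 ?addr_ge0 ?powR_ge0 ?(sums_below_ge0 (sumS 0)) ?(sums_below_ge0 sumM).
set F := u m `^ (sg - s) * _; have F0 : 0 <= F by rewrite mulr_ge0 ?powR_ge0.
have [N [mN PN NP]] := light_weights_null.
pose E i := stopped_paths (stop_heavy u) x i.+1 `|` stopped_paths (stop_long u r) x i.+1.
have mE i : measurable (E i) by apply: measurableU; exact: stopped_paths_measurable.
pose B := W x @^-1` `]u 0%N, +oo[.
have mB : measurable B.
  by rewrite -[X in measurable X]setTI; apply: measurable_funPT => //; exact: measurable_itv.
have mUE : measurable (\bigcup_(i < m) E i) by exact: bigcup_measurable.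
exists (N `|` (B `|` \bigcup_(i < m) E i)); split.
- by apply: measurableU => //; exact: measurableU.
- apply: le_trans (measureU2 P mN (measurableU _ _ mB mUE)) _.
  rewrite [X in (X + _)%E]PN add0e; apply: le_trans (measureU2 P mB mUE) _.
  rewrite [X in (X + _ <= _)%E](_ : _ = mu `]u 0%N, +oo[%classic); last first.
    by rewrite -(sfp_weight_law sfp x)//; exact: measurable_itv.
  rewrite leeD2l//.
  apply: (@le_trans _ _ (\sum_(i < m) (q0 ^+ i.+1 * (1 + F)))%:E).
    apply: (@finite_union_bound _ _ _ P m E (fun i => q0 ^+ i.+1 * (1 + F))) => //.
      by move=> i; rewrite mulr_ge0 ?exprn_ge0// addr_ge0.
    move=> i im; apply: le_trans (measureU2 P (stopped_paths_measurable _ _ _)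
      (stopped_paths_measurable _ _ _)) _.
    rewrite mulrC mulrDl EFinD leeD//.
      apply: (@stopped_paths_prob (stop_heavy u) 1) => //.
      by move=> y z k; exact: stop_heavy_cost.
    apply: (@stopped_paths_prob (stop_long u r) F) => //.
    by move=> y z k; exact: stop_long_cost.
  rewrite lee_fin -mulr_suml ler_wpM2r ?addr_ge0//.
  under eq_bigr do rewrite exprS.
  rewrite -mulr_sumr mulrC ler_wpM2r//.
  (* As q0 <= 1/2, the series of the q0^(i+1) is at most 2 q0, uniformly in [m]. *)
  apply: le_trans (geometric_sum_le _ _) _; first by rewrite q0_ge0/=; lra.
  by rewrite invf_ple ?posrE; lra.
- move=> w Uw q z qm uq pq; rewrite ltNge; apply/negP => rz; apply: Uw.
  have [Nw|/NP W1] := pselect (N w); [by left|right].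
  have [Wx|Wx] := ltP (u 0%N) (W x w); [by left; rewrite /B/= in_itv/= Wx|right].
  have W0 y : 0 < W y w by exact: lt_le_trans (W1 y).
  have ex_class y : exists k, W y w \in dyadic R k.
    have exk : exists k, W y w <= 2 ^+ k.
      exists (Num.truncn (W y w)).+1; apply: (@le_trans _ _ (Num.truncn (W y w)).+1%:R).
        by rewrite ltW// truncnS_gt.
      by rewrite -natrX ler_nat ltnW// ltn_expl.
    (* The least exponent gives the class: minimality is the lower endpoint for positive [k], and
       for k = 0 that endpoint is 1/2, below every weight. *)
    have [k kW kmin] := ex_minnP exk.
    exists k; rewrite inE /dyadic/= in_itv/= kW andbT.
    case: k kW kmin => [|k] kW kmin.
      by rewrite expr0 (lt_le_trans _ (W1 y)) ?mul1r ?invf_lt1 ?ltr1n.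
    rewrite exprS mulrAC divff ?mul1r// ltNge; apply/negP => /kmin.
    by rewrite ltnn.
  pose c y := projT1 (cid (ex_class y)).
  have cP y : W y w \in dyadic R (c y) by exact: projT2 (cid (ex_class y)).
  have [n nq fs] := first_stop_exists u c 0 rz.
  exists n; first by rewrite /= (leq_ltn_trans nq).
  set p := [seq (y, c y) | y <- take n.+1 (rcons q z)] in fs.
  have p1 : map fst p = take n.+1 (rcons q z) by rewrite -map_comp map_id.
  have up : uniq (x :: map fst p).
    rewrite p1; move: uq => /= /andP[xq uq]; rewrite take_uniq// andbT.
    by apply: contra xq; exact: mem_take.
  have pE : path_event (W := W) (G := G) (u 0%N) x p w.
    split; first by rewrite /= p1 take_path.
    split => /=; first by rewrite W0 Wx.
    by move=> e /mapP[y _ ->].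
  have sp : size p = n.+1 by rewrite size_map size_takel// size_rcons ltnS.
  by move/orP: fs => [fs|fs]; [left|right]; exists p; rewrite // ifT// up.
Qed.

End no_long_edge.

(** * Tails of the weight distribution *)

Section tails.
Context {R : realType}.
Variables (tau : R) (l : R -> R) (mu : probability R R).
Hypothesis law : weight_law tau l mu.

Let tail (t : R) : R := fine (mu `]t, +oo[%classic).

Lemma tailE t : 0 < t -> tail t = l t / t `^ (tau - 1).
Proof. by case: law => _ _ H t0; rewrite /tail H. Qed.

Lemma tail_itv t : mu `]t, +oo[%classic = (tail t)%:E.
Proof. by rewrite /tail fineK// fin_num_measure//; exact: measurable_itv. Qed.

Lemma tail_ge0 t : 0 <= tail t.
Proof. by rewrite fine_ge0. Qed.

Lemma tail_le1 t : tail t <= 1.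
Proof. by rewrite -lee_fin -tail_itv probability_le1//; exact: measurable_itv. Qed.

Lemma tail_nonincreasing t t' : t <= t' -> tail t' <= tail t.
Proof.
move=> tt'; rewrite -lee_fin -!tail_itv le_measure ?inE//; try exact: measurable_itv.
by apply: subset_itvr; rewrite bnd_simp.
Qed.

Lemma slowly_varying_near : exists2 X : R, 1 <= X & forall t, X <= t -> 0 < l t.
Proof.
case: law => _ [[X _ H] _] _; exists (Num.max 1 (X + 1)); first by rewrite le_max lexx.
by move=> t; rewrite ge_max => /andP[_ Xt]; apply: H; apply: lt_le_trans Xt; rewrite ltrDl.
Qed.

Lemma ratio_cvg : l (2 * t) / l t @[t --> +oo] --> (1 : R).
Proof. by case: law => _ [_ H] _; exact: H. Qed.

Lemma powR2_lt1 (x : R) : x < 0 -> 2 `^ x < 1.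
Proof. by move=> x0; rewrite /powR pnatr_eq0/= expR_lt1 pmulr_llt0// ln_gt0// ltr1n. Qed.

Lemma powR2_gt1 (x : R) : 0 < x -> 1 < 2 `^ x.
Proof. by move=> x0; rewrite /powR pnatr_eq0/= expR_gt1 mulr_gt0// ln_gt0// ltr1n. Qed.

Lemma powR2X (x : R) n : (2 `^ x) ^+ n = (2 ^+ n) `^ x.
Proof. by rewrite -powR_mulrn ?powR_ge0// -powRrM mulrC powRrM powR_mulrn. Qed.

(** Doubling t divides the tail by 2^(tau - 1) up to a ratio of values of [l] tending to 1, which an
    exponent vs > tau - 1 absorbs for large t. *)
Lemma tail_double_ge (vs : R) : tau - 1 < vs ->
  exists2 T0, 1 <= T0 & 0 < tail T0 /\ forall t, T0 <= t -> 2 `^ (- vs) * tail t <= tail (2 * t).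
Proof.
move=> vst; have [X X1 Xl] := slowly_varying_near.
have q1 : 2 `^ (tau - 1 - vs) < 1 by rewrite powR2_lt1// subr_lt0.
have := cvgr_gt 1 ratio_cvg _ q1.
move=> [Y [_ HY]]; pose T0 := Num.max X (Y + 1).
have XT0 : X <= T0 by rewrite le_max lexx.
exists T0; first exact: le_trans XT0.
split; first by rewrite tailE ?divr_gt0 ?powR_gt0 ?Xl// (lt_le_trans ltr01)// (le_trans X1).
move=> t T0t; have Xt : X <= t by exact: le_trans T0t.
have t0 : 0 < t by rewrite (lt_le_trans ltr01)// (le_trans X1).
have Yt : Y < t by apply: lt_le_trans T0t; rewrite lt_max ltrDl ltr01 orbT.
have := HY t Yt; rewrite ltr_pdivlMr ?Xl// => /ltW H.
rewrite !tailE ?mulr_gt0// powRM ?(ltW t0)// invfM.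
have -> : l (2 * t) * ((2 `^ (tau - 1))^-1 * (t `^ (tau - 1))^-1) =
  (2 `^ (tau - 1))^-1 * l (2 * t) / t `^ (tau - 1) by ring.
rewrite mulrA ler_pM2r ?invr_gt0 ?powR_gt0// -powRN.
have -> : 2 `^ (- vs) = 2 `^ (- (tau - 1)) * 2 `^ (tau - 1 - vs).
  by rewrite -powRD ?pnatr_eq0 ?implybT//; congr (_ `^ _); ring.
by rewrite -mulrA ler_pM2l// powR_gt0.
Qed.

Lemma tail_double_le (vs : R) : vs < tau - 1 ->
  exists2 T0, 1 <= T0 & forall t, T0 <= t -> tail (2 * t) <= 2 `^ (- vs) * tail t.
Proof.
move=> vst; have [X X1 Xl] := slowly_varying_near.
have q1 : 1 < 2 `^ (tau - 1 - vs) by rewrite powR2_gt1// subr_gt0.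
have := cvgr_lt 1 ratio_cvg _ q1.
move=> [Y [_ HY]]; pose T0 := Num.max X (Y + 1).
have XT0 : X <= T0 by rewrite le_max lexx.
exists T0; first exact: le_trans XT0.
move=> t T0t; have Xt : X <= t by exact: le_trans T0t.
have t0 : 0 < t by rewrite (lt_le_trans ltr01)// (le_trans X1).
have Yt : Y < t by apply: lt_le_trans T0t; rewrite lt_max ltrDl ltr01 orbT.
have := HY t Yt; rewrite ltr_pdivrMr ?Xl// => /ltW H.
rewrite !tailE ?mulr_gt0// powRM ?(ltW t0)// invfM.
have -> : l (2 * t) * ((2 `^ (tau - 1))^-1 * (t `^ (tau - 1))^-1) =
  (2 `^ (tau - 1))^-1 * l (2 * t) / t `^ (tau - 1) by ring.
rewrite mulrA ler_pM2r ?invr_gt0 ?powR_gt0// -powRN.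
have -> : 2 `^ (- vs) = 2 `^ (- (tau - 1)) * 2 `^ (tau - 1 - vs).
  by rewrite -powRD ?pnatr_eq0 ?implybT//; congr (_ `^ _); ring.
by rewrite -mulrA ler_pM2l// powR_gt0.
Qed.

Lemma dyadic_scale (T0 t : R) : 0 < T0 <= t ->
  exists n : nat, 2 ^+ n * T0 <= t <= 2 ^+ n.+1 * T0.
Proof.
move=> /andP[T00 T0t].
have ext : exists n, t < 2 ^+ n * T0.
  exists (Num.truncn (t / T0)).+1; rewrite -ltr_pdivrMr//.
  apply: lt_trans (truncnS_gt _) _.
  by rewrite -natrX ltr_nat ltn_expl.
have [n nt nmin] := ex_minnP ext; case: n nt nmin => [|n] nt nmin.
  by move: nt; rewrite expr0 mul1r ltNge T0t.
exists n; rewrite (ltW nt) andbT leNgt; apply/negP => /nmin.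
by rewrite ltnn.
Qed.

(** A Potter-type bound: the doubling estimate is iterated from T0, and monotonicity of the tail
    interpolates between 2^n T0 and 2^(n+1) T0. *)
Lemma tail_lower (vs : R) : 0 < vs -> tau - 1 < vs ->
  exists c T0, [/\ 0 < c, 1 <= T0 & forall t, T0 <= t -> c * t `^ (- vs) <= tail t].
Proof.
move=> vs0 vst; have [T0 T01 [gT0 H]] := tail_double_ge vst.
have T00 : 0 < T0 by exact: lt_le_trans T01.
have iter n : (2 ^+ n) `^ (- vs) * tail T0 <= tail (2 ^+ n * T0).
  elim: n => [|n IH]; first by rewrite expr0 powR1 !mul1r.
  rewrite exprS -mulrA; apply: le_trans (H _ _); last first.
    by rewrite ler_peMl ?exprn_ege1 ?ler1n// ltW.
  by rewrite powRM// -mulrA ler_wpM2l ?powR_ge0.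
exists ((2 / T0) `^ (- vs) * tail T0), T0; split => //.
  by rewrite mulr_gt0 ?powR_gt0 ?divr_gt0.
move=> t T0t; have /dyadic_scale[n /andP[nt tn]] : 0 < T0 <= t by rewrite T00.
have t0 : 0 < t by exact: lt_le_trans T0t.
apply: le_trans (tail_nonincreasing tn); apply: le_trans (iter _).
rewrite mulrAC ler_wpM2r ?tail_ge0// -powRM ?divr_ge0 ?(ltW T00) ?(ltW t0)//.
have T2t : 0 < 2 / T0 * t by rewrite mulr_gt0// divr_gt0.
rewrite !powRN lef_pV2 ?posrE ?powR_gt0 ?exprn_gt0//.
rewrite ge0_ler_powR ?nnegrE ?(ltW vs0) ?exprn_ge0 ?(ltW T2t)//.
by rewrite exprS mulrAC ler_pdivlMr// -mulrA ler_pM2l.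
Qed.

Lemma tail_upper (vs : R) : 0 < vs -> vs < tau - 1 ->
  exists2 C, 0 < C & forall t, 1 <= t -> tail t <= C * t `^ (- vs).
Proof.
move=> vs0 vst; have [T0 T01 H] := tail_double_le vst.
have T00 : 0 < T0 by exact: lt_le_trans T01.
have iter n : tail (2 ^+ n * T0) <= (2 ^+ n) `^ (- vs).
  elim: n => [|n IH]; first by rewrite expr0 powR1 mul1r tail_le1.
  rewrite exprS -mulrA; apply: le_trans (H _ _) _.
    by rewrite ler_peMl ?exprn_ege1 ?ler1n// ltW.
  by rewrite powRM// ler_wpM2l ?powR_ge0.
have T20 : 0 < 2 * T0 by rewrite mulr_gt0.
(* The factor T0^vs makes the bound trivial below T0, and 2^vs pays for rounding t down to 2^n
   T0. *)
exists ((2 * T0) `^ vs); first by rewrite powR_gt0.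
move=> t t1; have t0 : 0 < t by exact: lt_le_trans t1.
have [T0t|tT0] := leP T0 t; last first.
  apply: le_trans (tail_le1 t) _; rewrite powRN ler_pdivlMr ?powR_gt0// mul1r.
  rewrite ge0_ler_powR ?nnegrE ?(ltW vs0) ?(ltW t0) ?(ltW T20)//.
  by rewrite (le_trans (ltW tT0))// ler_peMl ?ler1n// ltW.
have /dyadic_scale[n /andP[nt tn]] : 0 < T0 <= t by rewrite T00.
apply: le_trans (tail_nonincreasing nt) _; apply: le_trans (iter n) _.
rewrite !powRN ler_pdivlMr ?powR_gt0// mulrC ler_pdivrMr ?powR_gt0 ?exprn_gt0//.
rewrite -powRM ?(ltW T20) ?exprn_ge0//.
rewrite ge0_ler_powR ?nnegrE ?mulr_ge0 ?exprn_ge0 ?(ltW vs0) ?(ltW t0) ?(ltW T20) ?(ltW T00)//.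
by rewrite (le_trans tn)// exprS mulrAC.
Qed.

Lemma moment_bounded (sg : R) : 0 < sg < tau - 1 ->
  exists M, sums_below (fun k => (2 ^+ k) `^ sg * fine (mu (dyadic R k))) M.
Proof.
move=> /andP[sg0 sgt]; pose vs := (sg + (tau - 1)) / 2.
have sgvs : sg < vs by rewrite /vs; lra.
have vst : vs < tau - 1 by rewrite /vs; lra.
have vs0 : 0 < vs by exact: lt_trans sgvs.
have [C C0 HC] := tail_upper vs0 vst.
have P2vs : 1 <= 2 `^ vs by rewrite ltW// powR2_gt1.
(* The summand 1 covers the class k = 0; class k + 1 is bounded by the tail at its lower endpoint
   2^k, whence 2^vs. *)
pose C' := 1 + C * 2 `^ vs.
have C'0 : 0 <= C' by rewrite addr_ge0 ?mulr_ge0 ?powR_ge0 ?(ltW C0).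
have HC' k : fine (mu (dyadic R k)) <= C' * (2 ^+ k) `^ (- vs).
  case: k => [|k].
    rewrite expr0 powR1 mulr1 (@le_trans _ _ 1)//; last first.
      by rewrite lerDl mulr_ge0 ?powR_ge0 ?(ltW C0).
    rewrite -lee_fin fineK ?fin_num_measure ?probability_le1//; exact: measurable_dyadic.
  apply: (@le_trans _ _ (tail (2 ^+ k))).
    rewrite -lee_fin -tail_itv fineK ?fin_num_measure//; try exact: measurable_dyadic.
    apply: le_measure; rewrite ?inE//; try exact: measurable_itv.
    move=> t; rewrite /dyadic/= !in_itv/= andbT => /andP[+ _].
    by rewrite exprS mulrAC divff// mul1r.
  apply: le_trans (HC _ _) _; first by rewrite exprn_ege1// ler1n.
  rewrite exprS powRM// mulrA ler_wpM2r ?powR_ge0//.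
  rewrite mulrDl mul1r -mulrA -powRD ?pnatr_eq0 ?implybT// subrr powRr0 mulr1.
  by rewrite lerDr powR_ge0.
pose q : R := 2 `^ (sg - vs).
have q01 : 0 <= q < 1 by rewrite powR_ge0/= powR2_lt1// subr_lt0.
exists (C' * (1 - q)^-1); apply: sums_below_nat => [k|n].
  by rewrite mulr_ge0 ?powR_ge0// fine_ge0.
apply: (@le_trans _ _ (\sum_(k < n) C' * q ^+ k)); last first.
  by rewrite -mulr_sumr ler_wpM2l// geometric_sum_le.
apply: ler_sum => k _; apply: le_trans (ler_wpM2l (powR_ge0 _ _) (HC' k)) _.
rewrite mulrCA /q powR2X -powRD ?expf_neq0 ?implybT//.
Qed.

End tails.

(** * Displacement along paths and elementary inequalities *)

Lemma sum_sqr_le_sqr_sum (R : realDomainType) (I : Type) (s : seq I) (f : I -> R) :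
  (forall i, 0 <= f i) -> \sum_(i <- s) f i ^+ 2 <= (\sum_(i <- s) f i) ^+ 2.
Proof.
move=> f0; elim: s => [|i s IH]; first by rewrite !big_nil expr0n.
rewrite !big_cons sqrrD -addrA lerD2l (le_trans IH)// lerDr.
by rewrite mulrn_wge0// mulr_ge0// sumr_ge0.
Qed.

Lemma enorm_le_sum (R : realType) (d : nat) (x : site d) :
  enorm R x <= \sum_(i < d) `|x ord0 i|%:~R.
Proof.
have S0 : 0 <= \sum_(i < d) `|x ord0 i|%:~R :> R by rewrite sumr_ge0// => i _; rewrite ler0z.
rewrite /enorm -[leRHS]ger0_norm// -sqrtr_sqr ler_sqrt ?sqr_ge0//.
apply: le_trans (sum_sqr_le_sqr_sum _ _); last by move=> i; rewrite ler0z.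
by apply: ler_sum => i _; rewrite intr_norm real_normK// num_real.
Qed.

Lemma enorm_le_coord (R : realType) (d : nat) (x : site d) (r : R) :
  (forall i, `|x ord0 i|%:~R <= r) -> enorm R x <= d%:R * r.
Proof.
move=> H; apply: le_trans (enorm_le_sum R x) _.
apply: (@le_trans _ _ (\sum_(i < d) r)); first exact: ler_sum.
by rewrite sumr_const card_ord mulr_natl.
Qed.

(** Arguing coordinatewise replaces the triangle inequality of the Euclidean norm; [enorm_le_coord]
    returns to the norm at the price of a factor d. *)
Lemma path_displacement (R : realType) (d : nat) (r : R) (p : seq (site d)) (x : site d) i :
  (forall q z t, p = q ++ z :: t -> enorm R (z - last x q) <= r) ->
  `|(last x p - x) ord0 i|%:~R <= (size p)%:R * r.
Proof.
elim: p x => [|z p IH] x H /=.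
  by rewrite subrr mxE normr0 mulr0z mul0r.
have Hz : enorm R (z - x) <= r by exact: (H [::] z p).
have {IH} H' : `|(last z p - z) ord0 i|%:~R <= (size p)%:R * r.
  by apply: IH => q y t pE; apply: (H (z :: q) y t); rewrite pE.
rewrite -natr1 mulrDl mul1r -(subrKA z) mxE.
rewrite intr_norm intrD; apply: le_trans (ler_normD _ _) _.
rewrite lerD//; first by rewrite -intr_norm.
by rewrite -intr_norm (le_trans (coord_le_enorm R _ i)).
Qed.

Lemma last_rev_belast (V : Type) (x0 z : V) (t : seq V) :
  last (last z t) (rev (belast z t)) = z.
Proof.
transitivity (last x0 (rev (z :: t))); last by rewrite rev_cons last_rcons.
by rewrite lastI rev_rcons.
Qed.

(** In a path of at most 2 m steps, an edge beyond the first m is among the first m of the reversed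
    path. This is the source of the factor 2 in the lower bound. *)
Lemma two_sided_edges (V : eqType) (e : rel V) (Q : V -> V -> Prop) (m : nat) (x y : V)
    (p : seq V) :
  symmetric e -> (forall a b, Q a b -> Q b a) ->
  (forall q z, (size q < m)%N -> uniq (x :: rcons q z) -> path e x (rcons q z) ->
     Q (last x q) z) ->
  (forall q z, (size q < m)%N -> uniq (y :: rcons q z) -> path e y (rcons q z) ->
     Q (last y q) z) ->
  uniq (x :: p) -> path e x p -> last x p = y -> (size p <= m.*2)%N ->
  forall q z t, p = q ++ z :: t -> Q (last x q) z.
Proof.
move=> es Qs Hx Hy up pp lp sp q z t pE.
have [qm|mq] := ltnP (size q) m.
  apply: Hx => //.
    by move: up; rewrite pE -cat_rcons -cat_cons cat_uniq => /andP[].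
  by move: pp; rewrite pE -cat_rcons cat_path => /andP[].
have rp : path e y (rev (belast x p)).
  have eE : (fun z => e^~ z) =2 e by move=> a b; rewrite /= es.
  by rewrite -lp rev_path (eq_path eE).
have ur : uniq (y :: rev (belast x p)).
  rewrite -lp -rev_rcons -lastI rev_uniq//.
have rE : rev (belast x p) = rcons (rev (belast z t)) (last x q) ++ rev (belast x q).
  by rewrite pE belast_cat rev_cat /= rev_cons.
have yE : y = last z t by rewrite -lp pE last_cat.
apply: Qs; rewrite -{1}(last_rev_belast x z t) -yE; apply: Hy.
- rewrite size_rev size_belast; move: sp mq.
  by rewrite pE size_cat /= -addnn; lia.
- by move: ur; rewrite rE -cat_cons cat_uniq => /andP[].
- by move: rp; rewrite rE cat_path => /andP[].
Qed.

Lemma expR_decay (R : realType) (K c e : R) : 0 < c -> 0 < e ->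
  exists2 A0, 1 <= A0 & forall A, A0 <= A -> K * expR (- (c * A)) <= e.
Proof.
move=> c0 e0; exists (Num.max 1 (`|K| / (c * e))); first by rewrite le_max lexx.
move=> A; rewrite ge_max => /andP[A1 AK].
have A0 : 0 < A by exact: lt_le_trans A1.
apply: le_trans (ler_wpM2r (expR_ge0 _) (ler_norm K)) _.
rewrite expRN ler_pdivrMr ?expR_gt0//.
apply: (@le_trans _ _ (e * (c * A))).
  have -> : e * (c * A) = A * (c * e) by ring.
  by rewrite -ler_pdivrMr ?mulr_gt0.
rewrite ler_pM2l//; have := expR_ge1Dx (c * A); lra.
Qed.

Lemma bernoulli_ge (R : realType) (x : R) n : 1 <= x -> 1 + n%:R * (x - 1) <= x ^+ n.
Proof.
move=> x1; elim: n => [|n IH]; first by rewrite mul0r addr0 expr0.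
have y0 : 0 <= x - 1 by rewrite subr_ge0.
rewrite exprS -natr1; apply: le_trans (ler_wpM2l _ IH); last by lra.
have := mulr_ge0 (ler0n R n) (mulr_ge0 y0 y0); nra.
Qed.

(** * Lower bound on the graph distance *)

(** Applied with x0 = d / alpha and g = gamma, so that g x0 = tau - 1. At s = x0 and sg = g x0 the
    last inequality reads 1 < (g - 1) th; being strict, it survives a shift of both exponents by a
    small [h]. *)
Lemma exponent_choice (R : realType) (x0 g th : R) :
  0 < x0 < 1 -> 1 < g < 2 -> 1 < (g - 1) * th -> 0 < th ->
  exists s sg, [/\ x0 < s <= 1, 0 < sg < g * x0, s <= sg, sg <= s + s &
    s < (sg - s) * th].
Proof.
move=> /andP[x00 x01] /andP[g1 g2] gth th0.
(* The shift h for which x0 + h equals (g x0 - h - (x0 + h)) th. *)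
pose k := x0 * ((g - 1) * th - 1) / (1 + 2 * th).
have k0 : 0 < k by rewrite /k divr_gt0 ?mulr_gt0 ?subr_gt0//; lra.
pose h := Num.min (1 - x0) k / 2.
have h0 : 0 < h by rewrite /h divr_gt0// lt_min subr_gt0 x01.
have h1 : h < 1 - x0.
  by rewrite /h ltr_pdivrMr// gt_min; apply/orP; left; lra.
have hk : h * (1 + 2 * th) < x0 * ((g - 1) * th - 1).
  rewrite -ltr_pdivlMr; last by lra.
  by rewrite -/k /h ltr_pdivrMr// gt_min; apply/orP; right; lra.
have key : x0 + h < (g * x0 - h - (x0 + h)) * th by nra.
have b0 : 0 < g * x0 - h - (x0 + h).
  by rewrite -(pmulr_lgt0 _ th0) mulrC; lra.
have gx : g * x0 < 2 * x0 by rewrite ltr_pM2r.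
by exists (x0 + h), (g * x0 - h); split; lra.
Qed.

Lemma expR_dominates (R : realType) (K nu : R) : nu < 1 ->
  exists2 L0, 1 <= L0 & forall L, L0 <= L -> K * expR (nu * L) <= expR L.
Proof.
move=> nu1; have nu0 : 0 < 1 - nu by rewrite subr_gt0.
have [L0 L01 H] := expR_decay K nu0 ltr01.
exists L0 => // L /H.
rewrite -(ler_pM2r (expR_gt0 L)) mul1r -mulrA -expRD.
by congr (_ * expR _ <= _); ring.
Qed.

Lemma powR_pos (R : realType) (a x : R) : 0 < a -> a `^ x = expR (x * ln a).
Proof. by move=> a0; rewrite /powR gt_eqF. Qed.

Lemma split_error (R : realType) (a q F eta : R) :
  a <= eta / 4 -> 0 <= q -> q <= eta / 16 -> F <= 1 ->
  a + 2 * q * (1 + F) <= eta / 2.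
Proof. by move=> a4 q0 q16 F1; have := ler_wpM2l q0 F1; lra. Qed.

Lemma edge_count (R : realType) (n d m p : R) :
  0 < n -> 0 < d -> 0 < m -> p < 2 * m -> d * (p * (n / (2 * m * d))) < n.
Proof.
move=> n0 d0 m0 pm.
have -> : d * (p * (n / (2 * m * d))) = p * n / (2 * m).
  by field; rewrite !gt_eqF.
by rewrite ltr_pdivrMr ?mulr_gt0// mulrC ltr_pM2l.
Qed.

Lemma potential_split (R : fieldType) (a b e t n : R) :
  e != 0 -> e * (a * b / e * t + n) = a * t * b + e * n.
Proof. by move=> e0; field. Qed.

Section lower_bound.
Context {R : realType} {d : nat} {alpha lambda tau : R} {l : R -> R}
  {mu : probability R R} {disp : measure_display}
  {T : measurableType disp} {P : probability T R}
  {W : site d -> {RV P >-> R}} {G : T -> rel (site d)}.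
Hypotheses (d1 : (1 <= d)%N) (d_alpha : d%:R < alpha) (lambda0 : 0 < lambda)
  (law : weight_law tau l mu)
  (sfp : scale_free_percolation alpha lambda mu W G).
Variable gamma : R.
Hypotheses (gammaE : gamma = alpha * (tau - 1) / d%:R)
  (gamma1 : 1 < gamma) (gamma2 : gamma < 2).

Lemma distance_lower_bound (c eta : R) : 0 < c -> c * `|ln (gamma - 1)| < 1 ->
  0 < eta ->
  exists M0 : R, forall x : site d, M0 < enorm R x ->
  exists U : set T, [/\ measurable U, (P U <= eta%:E)%E &
    forall w, ~ U w -> forall p, path (G w) 0 p -> last 0 p = x ->
      2 * c * ln (ln (enorm R x)) < (size p)%:R].
Proof.
move=> c0 ck eta0.
have d0 : 0 < d%:R :> R by rewrite ltr0n.
have a0 : 0 < alpha by exact: lt_trans d_alpha.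
have k01 : 0 < gamma - 1 < 1 by rewrite subr_gt0 gamma1 ltrBlDr.
have lnk : ln (gamma - 1) < 0 by rewrite ln_lt0.
(* y0 > |log kappa| gives kappa theta > 1, and y0 < 1/c makes theta^m of smaller order than log |x|
   for m close to c log log |x|. *)
pose y0 := (`|ln (gamma - 1)| + c^-1) / 2.
have ck' : `|ln (gamma - 1)| < c^-1.
  by rewrite -(ltr_pM2l c0) divff ?gt_eqF// mulrC.
have y0k : `|ln (gamma - 1)| < y0 by rewrite /y0; lra.
have y0_gt0 : 0 < y0 by apply: le_lt_trans y0k.
have cy0 : c * y0 < 1.
  by rewrite -ltr_pdivlMl// mulr1 /y0; lra.
pose th := expR y0.
have th1 : 1 < th by rewrite expR_gt1.
have th0 : 0 < th by exact: expR_gt0.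
have kth : 1 < (gamma - 1) * th.
  rewrite -[X in X * th]lnK ?posrE; last by case/andP: k01.
  rewrite -expRD expR_gt1; move: y0k.
  by rewrite ltr0_norm// -subr_gt0 opprK addrC.
have x01 : 0 < d%:R / alpha < 1.
  by rewrite divr_gt0//= ltr_pdivrMr// mul1r.
have [s [sg [/andP[ds s1] /andP[sg0 sgt] ssg sg2 key]]] :
    exists s sg, [/\ d%:R / alpha < s <= 1, 0 < sg < gamma * (d%:R / alpha),
      s <= sg, sg <= s + s & s < (sg - s) * th].
  by apply: exponent_choice => //; rewrite gamma1 gamma2.
have gx : gamma * (d%:R / alpha) = tau - 1.
  by rewrite gammaE; field; rewrite !gt_eqF.
rewrite gx in sgt.
have das : d%:R < alpha * s by rewrite mulrC -ltr_pdivrMr.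
pose b' := (d%:R + alpha * s) / 2.
have db' : d%:R < b' by rewrite /b'; lra.
have b'as : b' < alpha * s by rewrite /b'; lra.
have s0 : 0 < s by apply: lt_trans ds; case/andP: x01.
have s01 : 0 < s <= 1 by rewrite s0.
pose c1 := (sg - s) * th - s.
have c10 : 0 < c1 by rewrite subr_gt0.
have bs0 : 0 <= sg - s by rewrite subr_ge0.
have [S sumS] := lattice_sum_bounded d1 db'.
have [M sumM] : exists M, sums_below (fun k => (2 ^+ k) `^ sg * fine (mu (dyadic R k))) M.
  by apply: (moment_bounded law); rewrite sg0.
pose L1 := 1 + lambda `^ s.
pose vs := (tau - 1) / 2.
have vs0 : 0 < vs by rewrite /vs; lra.
have [C C0 tailC] : exists2 C, 0 < C & forall t, 1 <= t ->
    fine (mu `]t, +oo[%classic) <= C * t `^ (- vs).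
  by apply: (tail_upper law vs0); rewrite /vs; lra.
(* 1/2 is for the geometric series over path lengths; eta / 16 makes 2 q (1 + F) at most eta / 4
   once F <= 1. *)
have e8 : 0 < Num.min 2^-1 (eta / 16) by rewrite lt_min invr_gt0 ltr0n divr_gt0.
have e4 : 0 < eta / 4 by rewrite divr_gt0.
have [A1 A11 HA1] := expR_decay (L1 * (S * M)) c10 e8.
have [A2 A21 HA2] := expR_decay C vs0 e4.
pose A := Num.max A1 A2.
have {}HA1 : L1 * (S * M) * expR (- (c1 * A)) <= Num.min 2^-1 (eta / 16).
  by apply: HA1; rewrite le_max lexx.
have {}HA2 : C * expR (- (vs * A)) <= eta / 4.
  by apply: HA2; rewrite le_max lexx orbT.
have A0 : 0 < A by rewrite lt_max (lt_le_trans ltr01).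
pose u (j : nat) := expR (A * th ^+ j).
pose D := expR (- (c1 * A)).
have u_ge1 j : 1 <= u j.
  by rewrite /u -(@expR0 R) ler_expR mulr_ge0 ?exprn_ge0 ?(ltW A0) ?(ltW th0).
have u_mono : {homo u : i j / (i <= j)%N >-> i <= j}.
  by move=> i j ij; rewrite /u ler_expR ler_pM2l// ler_weXn2l// ltW.
have uD j : u j `^ s * u j.+1 `^ (s - sg) <= D.
  rewrite /u /D -!expRM -expRD ler_expR.
  have -> : A * th ^+ j * s + A * th ^+ j.+1 * (s - sg) = - (c1 * A * th ^+ j).
    by rewrite /c1 exprS; ring.
  rewrite lerN2 ler_peMr ?mulr_ge0 ?(ltW c10) ?(ltW A0)//.
  by rewrite exprn_ege1// ltW.
pose del := alpha * s - b'.
have del0 : 0 < del by rewrite subr_gt0.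
(* Chosen for F <= 1, that is A (sg - s) theta^m + del log N <= del log |x| with r = |x| / N: both
   terms on the left are at most multiples of theta^m, itself at most theta (log |x|)^(c y0). *)
pose K := (A * (sg - s) / del + 2 * d%:R / (th - 1)) * th.
have [L0 L01 HL] := expR_dominates K cy0.
exists (expR (expR L0)) => x xL0.
set n := enorm R x in xL0 *.
have n0 : 0 < n by exact: lt_trans (expR_gt0 _) xL0.
pose L := ln (ln n).
have lnn : expR L0 < ln n by rewrite -(expRK (expR L0)) ltr_ln ?posrE ?expR_gt0.
have lnn0 : 0 < ln n by exact: lt_trans (expR_gt0 _) lnn.
have LL0 : L0 < L by rewrite /L -(expRK L0) ltr_ln ?posrE ?expR_gt0.
have eL : expR L = ln n by rewrite /L lnK.
have L00 : 0 < L by rewrite (lt_trans _ LL0)// (lt_le_trans ltr01).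
pose m := (Num.truncn (c * L)).+1.
have cL0 : 0 <= c * L by rewrite mulr_ge0 ?(ltW c0) ?(ltW L00).
have mgt : c * L < m%:R by exact: truncnS_gt.
have mle : m%:R <= c * L + 1 by rewrite -natr1 lerD2r truncn_le.
have m0 : 0 < m%:R :> R by rewrite ltr0n.
have thm : th ^+ m <= th * expR (c * y0 * L).
  rewrite /th -expRM_natl -expRD ler_expR.
  by apply: le_trans (ler_wpM2r (ltW y0_gt0) mle) _; rewrite mulrDl mul1r addrC mulrAC.
(* Fewer than 2 m edges of length below |x| / N move each coordinate by less than |x| / d, so they
   cannot join 0 to x. *)
pose N := 2 * m%:R * d%:R : R.
have N0 : 0 < N by rewrite !mulr_gt0.
pose r := n / N.
have r0 : 0 < r by rewrite divr_gt0.
(* By Bernoulli's inequality m (theta - 1) <= theta^m, so log N is absorbed by the same power of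
   theta as log (u m). *)
have lnN : ln N <= 2 * d%:R / (th - 1) * th ^+ m.
  apply: le_trans (ltW (ln_sublinear N0)) _.
  have t1 : 0 < th - 1 by rewrite subr_gt0.
  have -> : N = 2 * d%:R / (th - 1) * (m%:R * (th - 1)).
    by rewrite /N; field; rewrite gt_eqF.
  rewrite ler_pM2l ?divr_gt0 ?mulr_gt0//.
  by rewrite (le_trans _ (bernoulli_ge m (ltW th1)))// lerDr.
have F1 : u m `^ (sg - s) * r `^ (b' - alpha * s) <= 1.
  rewrite (powR_pos _ r0) /u -expRM -expRD -(@expR0 R) ler_expR.
  rewrite /r ln_div ?posrE// -eL.
  have HK : K * expR (c * y0 * L) <= expR L by apply: HL; exact: ltW.
  have H1 : (A * (sg - s) / del + 2 * d%:R / (th - 1)) * th ^+ m <= expR L.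
    have K1 : 0 <= A * (sg - s) / del.
      by rewrite divr_ge0 ?mulr_ge0 ?(ltW A0) ?(ltW del0).
    have K2 : 0 <= 2 * d%:R / (th - 1).
      by rewrite divr_ge0 ?mulr_ge0 ?subr_ge0 ?(ltW d0) ?(ltW th1).
    by apply: le_trans HK; rewrite /K -[leRHS]mulrA ler_wpM2l// addr_ge0.
  have H2 : A * (sg - s) / del * th ^+ m + ln N <= expR L.
    by apply: le_trans H1; rewrite mulrDl lerD2l.
  have := ler_wpM2l (ltW del0) H2.
  rewrite potential_split ?gt_eqF//.
  have -> : b' - alpha * s = - del by rewrite /del opprB.
  by rewrite mulNr (mulrBr del) opprB addrA subr_le0.
have q0le : L1 * D * (S * M) <= Num.min 2^-1 (eta / 16).
  by apply: le_trans HA1; rewrite /D mulrAC.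
have /andP[q0h q0e] : (L1 * D * (S * M) <= 2^-1) && (L1 * D * (S * M) <= eta / 16).
  by move: q0le; rewrite le_min.
have mu1 : mu `[1, +oo[%classic = 1%E by case: law.
have NLE y := @no_long_edge R d alpha lambda s sg b' mu disp T P W G sfp mu1 u D S M
  lambda0 s01 ssg sg2 (ltW b'as) u_ge1 u_mono uD sumS sumM y m r r0 q0h.
have PU (U : set T) : (P U <= mu `]u 0%N, +oo[%classic +
    (2 * (L1 * D * (S * M)) * (1 + u m `^ (sg - s) * r `^ (b' - alpha * s)))%:E)%E ->
    (P U <= (eta / 2)%:E)%E.
  move=> H; apply: le_trans H _; rewrite (tail_itv mu) -EFinD lee_fin.
  have : fine (mu `]u 0%N, +oo[%classic) <= eta / 4.
    apply: le_trans (tailC _ (u_ge1 _)) _.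
    by rewrite /u expr0 mulr1 -expRM mulrN mulrC mulrC (mulrC A).
  have q00 : 0 <= L1 * D * (S * M).
    by rewrite !mulr_ge0 ?addr_ge0 ?powR_ge0 ?expR_ge0
      ?(sums_below_ge0 (sumS 0)) ?(sums_below_ge0 sumM).
  move: F1 q00 q0e; set q := L1 * _ * _; set F := u m `^ _ * _ => F1 q00 q0e.
  by move=> tl; exact: split_error.
have [U0 [mU0 PU0 HU0]] := NLE 0.
have [Ux [mUx PUx HUx]] := NLE x.
exists (U0 `|` Ux); split.
- exact: measurableU.
- apply: le_trans (measureU2 P mU0 mUx) _.
  by rewrite [eta]splitr EFinD leeD// PU.
- move=> w /not_orP[NU0 NUx] p pp lp.
  rewrite ltNge; apply/negP => spL.
  (* The excluded event concerns self-avoiding paths, and removing loops does not lengthen a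
     path. *)
  case: (shortenP pp) lp => p' pp' up' sub lp.
  have sp' : (size p' <= size p)%N.
    by apply: uniq_leq_size => //; move: up' => /= /andP[].
  have sm : (size p' < m.*2)%N.
    rewrite -(ltr_nat R) -mul2n natrM (@le_lt_trans _ _ (size p)%:R) ?ler_nat//.
    by rewrite (le_lt_trans spL)// -mulrA ltr_pM2l.
  have Hedge : forall q z t, p' = q ++ z :: t -> enorm R (z - last 0 q) < r.
    apply: (@two_sided_edges _ (G w) (fun a b => enorm R (b - a) < r) m 0 x) => //.
    - exact: (sfp_edge_sym sfp).
    - by move=> a b; rewrite enormB.
    - by move=> q z; exact: HU0.
    - by move=> q z; exact: HUx.
    - exact: ltnW.
  have Hcoord i : `|x ord0 i|%:~R <= (size p')%:R * r.
    have := @path_displacement R d r p' 0 i; rewrite lp subr0; apply.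
    by move=> q z t /Hedge/ltW.
  have := enorm_le_coord Hcoord; rewrite leNgt => /negP; apply.
  rewrite -/n; apply: edge_count => //.
  by rewrite -natrM ltr_nat mul2n.
Qed.

End lower_bound.

(** * Hubs and boxes *)

(** Failures at scale X are bounded by a polynomial count times a stretched exponential; the form C
    / X makes them summable over the scales. A single term of the exponential series, of degree at
    least (E + 1) / eta, suffices. *)
Lemma powR_expR_bounded (R : realType) (E c eta : R) : 0 < c -> 0 < eta ->
  exists2 C, 0 <= C & forall X, 1 <= X ->
    X `^ E * expR (- (c * X `^ eta)) <= C * X^-1.
Proof.
move=> c0 eta0; pose n := Num.truncn (`|E + 1| / eta).
exists (n.+1`!%:R / c ^+ n.+1); first by rewrite divr_ge0 ?exprn_ge0// ltW.
move=> X X1; have X0 : 0 < X by exact: lt_le_trans X1.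
have y0 : 0 < c * X `^ eta by rewrite mulr_gt0// powR_gt0.
have fact0 : 0 < n.+1`!%:R :> R by rewrite ltr0n fact_gt0.
have H : (c * X `^ eta) ^+ n.+1 / n.+1`!%:R <= expR (c * X `^ eta).
  by apply: le_trans (expR_ge1Dxn n (ltW y0)); rewrite lerDr.
rewrite expRN ler_pdivrMr ?expR_gt0//.
have C0 : 0 <= n.+1`!%:R / c ^+ n.+1 * X^-1.
  by rewrite !mulr_ge0 ?invr_ge0 ?exprn_ge0 ?(ltW c0) ?(ltW X0).
apply: le_trans (ler_wpM2l C0 H).
have -> : n.+1`!%:R / c ^+ n.+1 / X * ((c * X `^ eta) ^+ n.+1 / n.+1`!%:R) =
    (X `^ eta) ^+ n.+1 / X.
  rewrite exprMn; move: (c ^+ _) (exprn_gt0 n.+1 c0) => a a0.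
  by field; rewrite !gt_eqF.
rewrite ler_pdivlMr// -powR_mulrn ?powR_ge0// -powRrM.
rewrite -[X in _ * X <= _]powRr1 ?(ltW X0)// -powRD ?(gt_eqF X0) ?implybT//.
rewrite ler_powR// mulrC -ler_pdivrMr//.
apply: (@le_trans _ _ (`|E + 1| / eta)); first by rewrite ler_pM2r ?invr_gt0// ler_norm.
exact/ltW/truncnS_gt.
Qed.

Section reach.
Variables (V : Type) (e : rel V).

Definition reach (a b : V) (n : nat) : Prop :=
  exists p, [/\ path e a p, last a p = b & (size p <= n)%N].

Lemma reach0 a : reach a a 0.
Proof. by exists [::]. Qed.

Lemma reach_edge a b : e a b -> reach a b 1.
Proof. by move=> ab; exists [:: b]; rewrite /= ab. Qed.

Lemma reach_trans b a c n m : reach a b n -> reach b c m -> reach a c (n + m).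
Proof.
move=> [p [pp lp sp]] [q [pq lq sq]]; exists (p ++ q).
by rewrite cat_path last_cat lp pp pq lq size_cat leq_add.
Qed.

Lemma reach_le a b n m : (n <= m)%N -> reach a b n -> reach a b m.
Proof. by move=> nm [p [pp lp sp]]; exists p; split => //; exact: leq_trans nm. Qed.

Lemma reach_sym a b n : symmetric e -> reach a b n -> reach b a n.
Proof.
move=> es [p [pp lp sp]]; exists (rev (belast a p)); split.
- have eE : (fun z => e^~ z) =2 e by move=> x y; rewrite /= es.
  by rewrite -lp rev_path (eq_path eE).
- case: p {pp sp} lp => [//|x p] /= <-.
  by rewrite rev_cons last_rcons.
- by rewrite size_rev size_belast.
Qed.

End reach.

(** [y] is a corner, not the centre: boxes with the same [y] are nested, and offsets are natural
    numbers. *)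
Definition box (d : nat) (y : site d) (n : nat) : seq (site d) :=
  [seq y + \row_i (f i)%:Z | f : {ffun 'I_d -> 'I_n}].

Lemma box_uniq d (y : site d) n : uniq (box y n).
Proof.
rewrite map_inj_uniq ?enum_uniq// => f g /addrI /rowP fg.
by apply/ffunP => i; have := fg i; rewrite !mxE => -[] /val_inj.
Qed.

Lemma size_box d (y : site d) n : size (box y n) = (n ^ d)%N.
Proof. by rewrite size_image cardE -cardE card_ffun !card_ord. Qed.

Lemma box_coord d (y z : site d) n i : z \in box y n ->
  (0 <= (z - y) ord0 i < n%:Z).
Proof.
move=> /mapP[f _ ->]; rewrite addrAC subrr add0r mxE.
by rewrite ltz_nat ltn_ord andbT.
Qed.

Lemma box_diff (R : realType) d (y z y' z' : site d) n n' i :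
  z \in box y n -> z' \in box y' n' -> (n <= n')%N ->
  `|(z - z') ord0 i|%:~R <= n'%:R + enorm R (y' - y).
Proof.
move=> /(box_coord i) + /(box_coord i) + nn'; rewrite !mxE => zb zb'.
apply: (@le_trans _ _ ((n'%:Z + `|(y' - y) ord0 i|)%:~R)).
  rewrite ler_int !mxE; move: (z ord0 i) (y ord0 i) (z' ord0 i) (y' ord0 i) zb zb'.
  by move=> a b a' b'; lia.
by rewrite intrD lerD// coord_le_enorm.
Qed.

Lemma enorm_delta (R : realType) d (i : 'I_d) :
  enorm R (delta_mx ord0 i : site d) = 1.
Proof.
rewrite /enorm (bigD1 i)//= big1 => [|j ji]; first by rewrite mxE !eqxx addr0 expr1n sqrtr1.
by rewrite mxE (negbTE ji) andbF expr0n.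
Qed.

Section lattice_reach.
Context {R : realType} {d : nat} {alpha lambda : R} {mu : probability R R}
  {disp : measure_display} {T : measurableType disp} {P : probability T R}
  {W : site d -> {RV P >-> R}} {G : T -> rel (site d)}.
Hypothesis sfp : scale_free_percolation alpha lambda mu W G.

Lemma lattice_reach (v : site d) :
  exists n, forall w a, reach (G w) a (a + v) n.
Proof.
pose Q (v : site d) := exists n, forall w a, reach (G w) a (a + v) n.
have Q0 : Q 0 by exists 0%N => w a; rewrite addr0; exact: reach0.
have QD u v' : Q u -> Q v' -> Q (u + v').
  move=> [n Hn] [m Hm]; exists (n + m)%N => w a; rewrite addrA.
  exact: reach_trans (Hn w a) (Hm w _).
have Q1 (u : site d) : enorm R u = 1 -> Q u.
  move=> u1; exists 1%N => w a; apply: reach_edge.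
  by apply: (sfp_nearest_neighbour sfp); rewrite opprD addNKr enormN.
have QZ (u : site d) n : Q u -> Q (n%:Z *: u).
  move=> Qu; elim: n => [|n IH]; first by rewrite scale0r.
  by rewrite intS scalerDl scale1r; exact: QD.
rewrite -/(Q v) (row_sum_delta v); apply: (big_ind Q) => // i _.
case: (v ord0 i) => n; first by apply: QZ; apply: Q1; exact: enorm_delta.
rewrite NegzE scaleNr -scalerN; apply: QZ; apply: Q1.
by rewrite enormN enorm_delta.
Qed.

(** Nearest-neighbour edges are always present, so entering the chain costs a deterministic number
    of steps, which ends up in the additive constant of the upper bound. *)
Lemma box_reach n : exists N, forall w (y z : site d), z \in box y n ->
  reach (G w) y z N.
Proof.
pose Q (f : {ffun 'I_d -> 'I_n}) m := forall w a,
  reach (G w) a (a + \row_i (f i)%:Z) m.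
have [F HF] : exists F, forall f, Q f (F f).
  by apply/fin_all_exists => f; exact: lattice_reach.
exists (\max_f F f) => w y z /mapP[f _ ->].
by apply: reach_le (HF f w y); exact: leq_bigmax.
Qed.

End lattice_reach.

(** * Existence and adjacency of hubs *)

Section hub_probabilities.
Context {R : realType} {d : nat} {alpha lambda : R} {mu : probability R R}
  {disp : measure_display} {T : measurableType disp} {P : probability T R}
  {W : site d -> {RV P >-> R}} {G : T -> rel (site d)}.
Hypothesis sfp : scale_free_percolation alpha lambda mu W G.
Hypotheses (lambda0 : 0 < lambda) (alpha0 : 0 < alpha).

Definition no_hub (s : seq (site d)) (t : R) : set T :=
  \bigcap_(z in [set` s]) W z @^-1` (~` `]t, +oo[).

Lemma no_hub_measurable s t : measurable (no_hub s t).
Proof.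
apply: cylinder_measurable => z.
by apply: measurableC; exact: measurable_itv.
Qed.

Lemma no_hub_prob (s : seq (site d)) (t : R) : uniq s ->
  (P (no_hub s t) <=
   (expR (- (fine (mu `]t, +oo[%classic) * (size s)%:R)))%:E)%E.
Proof.
move=> us.
have mB : measurable (~` `]t, +oo[%classic : set R).
  by apply: measurableC; exact: measurable_itv.
have PB : mu (~` `]t, +oo[) = (1 - fine (mu `]t, +oo[%classic))%:E.
  rewrite probability_setC; last exact: measurable_itv.
  by rewrite EFinB -tail_itv.
rewrite /no_hub (cylinder_prob sfp us (fun _ => mB)).
under eq_bigr do rewrite PB.
rewrite prodEFin lee_fin big_const_seq iter_mulr_1.
rewrite -mulNr expRM_natr count_predT lerXn2r ?nnegrE ?expR_ge0//.
  by rewrite subr_ge0 tail_le1.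
by have := expR_ge1Dx (- fine (mu `]t, +oo[%classic)).
Qed.

(** Excluding this event for all pairs of two boxes avoids a measurable choice of the random hubs.
    The case y = z is left out because hubs of overlapping boxes may coincide, which costs no
    step. *)
Definition missing_edge (y z : site d) (t t' : R) : set T :=
  [set w | [/\ y != z, t < W y w, t' < W z w & ~~ G w y z]].

Lemma missing_edge_cylinder y z t t' : y != z ->
  missing_edge y z t t' =
  (\bigcap_(a in [set` [:: y; z]]) W a @^-1`
     (if a == y then `]t, +oo[%classic else `]t', +oo[%classic))
  `\` [set w | forall e, e \in [:: (y, z)] -> G w e.1 e.2].
Proof.
move=> yz; apply/seteqP; split => w.
  move=> [_ ty tz nG]; split => [a /=|H]; last first.
    by move: nG; rewrite (H (y, z) (mem_head _ _)).
  rewrite !inE => /orP[/eqP->|/eqP->]; first by rewrite /preimage/= eqxx/= in_itv/= ty.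
  by rewrite /preimage/= eq_sym (negbTE yz)/= in_itv/= tz.
move=> [H nG]; split => //.
- by have := H y; rewrite /= !inE !eqxx /= in_itv/= andbT; exact.
- have := H z; rewrite /= !inE eqxx orbT eq_sym (negbTE yz)/= in_itv/= andbT.
  exact.
- by apply/negP => Gyz; apply: nG => e; rewrite inE => /eqP->.
Qed.

Lemma missing_edge_measurable y z t t' : measurable (missing_edge y z t t').
Proof.
have [->|yz] := eqVneq y z.
  rewrite (_ : missing_edge _ _ _ _ = set0)//.
  by apply/seteqP; split => w // -[]; rewrite eqxx.
rewrite missing_edge_cylinder//; apply: measurableD; last exact: (measurable_edges sfp).
by apply: cylinder_measurable => a; case: ifP => _; exact: measurable_itv.
Qed.

(** On the event C that both weights are large, the conditional edge probability is at least 1 - q,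
    so the edge is absent on C with probability at most q P(C) <= q. *)
Lemma missing_edge_prob (y z : site d) (t t' Dm : R) :
  0 < t -> 0 < t' -> enorm R (y - z) <= Dm ->
  (P (missing_edge y z t t') <= (expR (- (lambda * t * t' / Dm `^ alpha)))%:E)%E.
Proof.
move=> t0 t'0 yzD.
have [->|yz] := eqVneq y z.
  rewrite (_ : missing_edge _ _ _ _ = set0) ?measure0 ?lee_fin ?expR_ge0//.
  by apply/seteqP; split => w // -[]; rewrite eqxx.
have e1 : 1 <= enorm R (y - z) by rewrite enorm_ge1// subr_eq0.
have [e11|] := ltP 1 (enorm R (y - z)); last first.
  move=> e1'; rewrite (_ : missing_edge _ _ _ _ = set0) ?measure0 ?lee_fin ?expR_ge0//.
  apply/seteqP; split => w // -[_ _ _]; rewrite (sfp_nearest_neighbour sfp)//.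
  by apply/eqP; rewrite eq_le e1 e1'.
rewrite missing_edge_cylinder//.
pose B (a : site d) : set R := if a == y then `]t, +oo[%classic else `]t', +oo[%classic.
have mB a : measurable (B a) by rewrite /B; case: ifP => _; exact: measurable_itv.
set C := \bigcap_(a in _) _; set A := [set w | _].
have mC : measurable C by exact: (cylinder_measurable [:: y; z] mB).
have mA : measurable A by exact: (measurable_edges sfp).
set q := expR _; have q1 : q <= 1.
  rewrite expR_le1 oppr_le0 divr_ge0 ?powR_ge0//.
  by rewrite !mulr_ge0 ?(ltW lambda0) ?(ltW t0) ?(ltW t'0).
have lp : long_pairs R [:: (y, z)].
  split => // e; rewrite inE => /eqP ->; split => //=.
  by rewrite inE; apply: contra yz => /eqP[->].
have H : ((1 - q)%:E * P C <= P (A `&` C))%E.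
  apply: (edges_cylinder_ge sfp (B := B)) => //; first by rewrite subr_ge0.
  move=> w Cw; rewrite big_seq1 /edge_prob/= lerD2l lerN2 ler_expR lerN2.
  have Wy : t < W y w.
    by have := Cw y; rewrite /= !inE /B !eqxx /= in_itv/= andbT; exact.
  have Wz : t' < W z w.
    have := Cw z; rewrite /= !inE eqxx orbT /B eq_sym (negbTE yz)/= in_itv/= andbT.
    exact.
  have e0 : 0 < enorm R (y - z) by exact: lt_le_trans e1.
  have D0 : 0 < Dm by exact: lt_le_trans yzD.
  rewrite ler_pM ?invr_ge0 ?powR_ge0// ?mulr_ge0 ?(ltW lambda0) ?(ltW t0) ?(ltW t'0)//.
    rewrite ler_pM ?mulr_ge0 ?(ltW lambda0) ?(ltW t0) ?(ltW t'0) ?(ltW Wz)//.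
    by rewrite ler_pM2l// ltW.
  rewrite lef_pV2 ?posrE ?powR_gt0// ge0_ler_powR ?nnegrE ?(ltW alpha0) ?(ltW e0) ?(ltW D0)//.
rewrite measureD//; last by rewrite ltey_eq fin_num_measure.
have PC1 : (P C <= 1)%E by exact: probability_le1.
have fC : P C \is a fin_num by exact: fin_num_measure.
have fCA : P (A `&` C) \is a fin_num by apply: fin_num_measure; exact: measurableI.
rewrite setIC; apply: (@le_trans _ _ ((fine (P C))%:E - (fine (P (A `&` C)))%:E)%E).
  by rewrite !fineK.
move: H PC1; rewrite -{1 2}(fineK fC) -(fineK fCA) -EFinM -EFinB !lee_fin /=.
move: (fine _) (fine _) (expR_ge0 (- (lambda * t * t' / Dm `^ alpha))) => a b.
by rewrite -/q => q0 H a1; have := ler_wpM2l q0 a1; lra.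
Qed.

Definition missing_edges (s s' : seq (site d)) (t t' : R) : set T :=
  \bigcup_(y in [set` s]) \bigcup_(z in [set` s']) missing_edge y z t t'.

Lemma missing_edges_measurable s s' t t' : measurable (missing_edges s s' t t').
Proof.
apply: fin_bigcup_measurable => // y _; apply: fin_bigcup_measurable => // z _.
exact: missing_edge_measurable.
Qed.

Lemma missing_edges_prob (s s' : seq (site d)) (t t' Dm : R) :
  0 < t -> 0 < t' ->
  (forall y z, y \in s -> z \in s' -> enorm R (y - z) <= Dm) ->
  (P (missing_edges s s' t t') <=
   ((size s)%:R * (size s')%:R * expR (- (lambda * t * t' / Dm `^ alpha)))%:E)%E.
Proof.
move=> t0 t'0 sD; pose x0 : site d := 0.
set q := expR _; have q0 : 0 <= q by exact: expR_ge0.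
pose E i := \bigcup_(z in [set` s']) missing_edge (nth x0 s i) z t t'.
pose E' i j := missing_edge (nth x0 s i) (nth x0 s' j) t t'.
have EE' i : E i = \bigcup_(j < size s') E' i j.
  apply/seteqP; split => w.
    move=> [z /= zs H]; exists (index z s'); first by rewrite /= index_mem.
    by rewrite /E' nth_index.
  by move=> [j /= js H]; exists (nth x0 s' j) => //=; rewrite mem_nth.
have mE' i j : measurable (E' i j) by exact: missing_edge_measurable.
have mE i : measurable (E i).
  by apply: fin_bigcup_measurable => // z _; exact: missing_edge_measurable.
have -> : missing_edges s s' t t' = \bigcup_(i < size s) E i.
  apply/seteqP; split => w.
    move=> [z /= zs H]; exists (index z s); first by rewrite /= index_mem.
    by rewrite /E nth_index.
  by move=> [j /= js H]; exists (nth x0 s j) => //=; rewrite mem_nth.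
apply: le_trans.
  apply: (@finite_union_bound _ _ _ P (size s) E (fun _ => (size s')%:R * q)) => //.
    by move=> i; rewrite mulr_ge0.
  move=> i si; rewrite EE'; apply: le_trans.
    apply: (@finite_union_bound _ _ _ P (size s') (E' i) (fun _ => q)) => //.
    by move=> j sj; apply: missing_edge_prob => //; apply: sD; exact: mem_nth.
  by rewrite sumr_const card_ord mulr_natl.
by rewrite sumr_const card_ord lee_fin -[leLHS]mulr_natl mulrA.
Qed.

End hub_probabilities.

Section hub_chain.
Context {R : realType} {d : nat} {alpha lambda tau : R} {l : R -> R}
  {mu : probability R R} {disp : measure_display}
  {T : measurableType disp} {P : probability T R}
  {W : site d -> {RV P >-> R}} {G : T -> rel (site d)}.
Hypothesis sfp : scale_free_percolation alpha lambda mu W G.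
Hypotheses (lambda0 : 0 < lambda) (alpha0 : 0 < alpha) (d1 : (1 <= d)%N).

Lemma not_missing_reach s s' (t t' : R) w y z :
  ~ missing_edges (W := W) (G := G) s s' t t' w -> y \in s -> z \in s' ->
  t < W y w -> t' < W z w -> reach (G w) y z 1.
Proof.
move=> H ys zs ty tz; have [->|yz] := eqVneq y z.
  exact: reach_le (reach0 _ _).
apply: reach_edge; apply: contrapT => /negP nG; apply: H.
by exists y => //; exists z.
Qed.

Lemma hub_exists s (t : R) w : ~ no_hub (W := W) s t w ->
  exists2 h, h \in s & t < W h w.
Proof.
move=> H; apply: contrapT => nex; apply: H => z zs /=.
by rewrite in_itv/= andbT => tz; apply: nex; exists z.
Qed.

Lemma hub_chain w y (n : nat -> nat) (t : nat -> R) K N0 :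
  (forall z, z \in box y (n 0%N) -> reach (G w) y z N0) ->
  (forall k, (k <= K)%N -> ~ no_hub (W := W) (box y (n k)) (t k) w) ->
  (forall k, (k < K)%N -> ~ missing_edges (W := W) (G := G) (box y (n k)) (box y (n k.+1))
     (t k) (t k.+1) w) ->
  forall k, (k <= K)%N -> exists h, [/\ h \in box y (n k), t k < W h w &
    reach (G w) y h (N0 + k)].
Proof.
move=> H0 Hh Hm; elim=> [|k IH] kK.
  have [h hb th] := hub_exists (Hh _ kK).
  by exists h; split => //; rewrite addn0; exact: H0.
have [h [hb th rh]] := IH (ltnW kK).
have [h' hb' th'] := hub_exists (Hh _ kK).
exists h'; split => //; rewrite addnS -[(N0 + k).+1]addn1; apply: reach_trans rh _.
exact: not_missing_reach (Hm k kK) hb hb' th th'.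
Qed.

Lemma no_hub_box (X rho vs ct : R) (n : nat) (y : site d) :
  0 <= ct -> 1 <= X -> X <= n%:R ->
  ct * (X `^ rho) `^ (- vs) <= fine (mu `]X `^ rho, +oo[%classic) ->
  (P (no_hub (W := W) (box y n) (X `^ rho)) <=
    (expR (- (ct * X `^ (d%:R - rho * vs))))%:E)%E.
Proof.
move=> ct0 X1 Xn H; have X0 : 0 < X by exact: lt_le_trans X1.
apply: le_trans (no_hub_prob sfp _ (box_uniq _ _)) _.
rewrite lee_fin ler_expR lerN2 size_box.
have -> : ct * X `^ (d%:R - rho * vs) = ct * (X `^ rho) `^ (- vs) * X ^+ d.
  rewrite -powR_mulrn ?(ltW X0)// -powRrM -mulrA -powRD ?(gt_eqF X0) ?implybT//.
  by congr (_ * _ `^ _); ring.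
rewrite ler_pM ?mulr_ge0 ?powR_ge0 ?exprn_ge0 ?(ltW X0)//.
by rewrite natrX lerXn2r ?nnegrE ?(ltW X0).
Qed.

(** The corners are free so as to serve both consecutive boxes of a chain (y' = y) and the two final
    boxes (th = 1). The constant 3 is 2 for the larger side plus 1 for the offset. *)
Lemma missing_box (X th rho : R) (n n' : nat) (y y' : site d) :
  1 <= X -> n%:R <= 2 * X -> n'%:R <= 2 * X `^ th -> (n <= n')%N ->
  enorm R (y' - y) <= X `^ th ->
  (P (missing_edges (W := W) (G := G) (box y n) (box y' n') (X `^ rho) ((X `^ th) `^ rho)) <=
    (4 ^+ d * (X `^ (d%:R + th * d%:R) *
      expR (- (lambda / (d%:R * 3) `^ alpha *
        X `^ (rho + th * rho - th * alpha)))))%:E)%E.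
Proof.
move=> X1 nX nX' nn' yy'; have X0 : 0 < X by exact: lt_le_trans X1.
have Xth0 : 0 < X `^ th by rewrite powR_gt0.
have d0 : 0 < d%:R :> R by rewrite ltr0n.
apply: le_trans.
  apply: (missing_edges_prob sfp lambda0 alpha0 (Dm := d%:R * 3 * X `^ th)).
  - by rewrite powR_gt0.
  - by rewrite powR_gt0.
  - move=> z z' zb zb'; rewrite -mulrA; apply: enorm_le_coord => i.
    apply: le_trans (box_diff R i zb zb' nn') _.
    by apply: le_trans (lerD nX' yy') _; rewrite le_eqVlt; apply/orP; left; apply/eqP; ring.
rewrite lee_fin !size_box mulrA ler_pM ?expR_ge0 ?mulr_ge0//.
  rewrite !natrX.
  have -> : 4 ^+ d * X `^ (d%:R + th * d%:R) = (2 * X) ^+ d * (2 * X `^ th) ^+ d.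
    rewrite powRD ?(gt_eqF X0) ?implybT// (powRrM X) !powR_mulrn ?powR_ge0 ?(ltW X0)//.
    by rewrite !exprMn (_ : 4 = 2 * 2) ?exprMn; [ring|rewrite -natrM].
  rewrite ler_pM ?exprn_ge0// lerXn2r ?nnegrE ?mulr_ge0 ?powR_ge0 ?(ltW X0)//.
rewrite ler_expR lerN2 [(d%:R * 3 * _) `^ _]powRM ?powR_ge0 ?mulr_ge0 ?(ltW d0)// invfM.
rewrite -!powRrM powRB ?(gt_eqF X0) ?implybT// powRD ?(gt_eqF X0) ?implybT//.
rewrite le_eqVlt; apply/orP; left; apply/eqP.
by move: (X `^ _) (X `^ _) (X `^ _) => a b e; ring.
Qed.

End hub_chain.

(** * Upper bound on the graph distance *)

(** Adjacency asks for rho > alpha th / (1 + th), existence of hubs for rho < D / (tau - 1); the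
    hypothesis says that this window is not empty. Then [vs] fits between tau - 1 and D / rho. *)
Lemma hub_exponent_choice (R : realFieldType) (alpha th tau D : R) :
  0 < alpha -> 0 < th -> 1 < tau -> 0 < D -> alpha * th * (tau - 1) < D * (1 + th) ->
  exists rho vs, [/\ 0 < rho, tau - 1 < vs, 0 < D - rho * vs &
    0 < rho + th * rho - th * alpha].
Proof.
move=> a0 th0 tau1 D0 key.
have t0 : 0 < tau - 1 by rewrite subr_gt0.
have h0 : 0 < 1 + th by rewrite addr_gt0.
pose lo := alpha * th / (1 + th); pose hi := D / (tau - 1).
have lohi : lo < hi by rewrite /lo /hi ltr_pdivrMr// mulrAC ltr_pdivlMr.
have lo0 : 0 < lo by rewrite /lo divr_gt0// mulr_gt0.
pose rho := (lo + hi) / 2.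
have lr : lo < rho by rewrite /rho; lra.
have rh : rho < hi by rewrite /rho; lra.
have r0 : 0 < rho by exact: lt_trans lr.
have tD : tau - 1 < D / rho by rewrite ltr_pdivlMr// mulrC -ltr_pdivlMr.
exists rho, ((tau - 1 + D / rho) / 2); split => //.
- by move: (D / rho) tD => z; lra.
- rewrite subr_gt0 mulrC -ltr_pdivlMr//.
  by move: (D / rho) tD => z; lra.
- have : lo * (1 + th) < rho * (1 + th) by rewrite ltr_pM2r.
  by rewrite /lo divfK ?gt_eqF//; move: rho {lr rh r0 tD} => rho; lra.
Qed.

(** By Bernoulli's inequality th^k >= 1 + k (th - 1), the series is dominated by a geometric one of
    ratio at most 1/2, whatever [K]. *)
Lemma inverse_sum_le (R : realType) (A th : R) (K : nat) : 0 <= A -> 1 <= th ->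
  expR (- ((th - 1) * A)) <= 2^-1 ->
  \sum_(k < K) (expR (A * th ^+ k))^-1 <= 2 * expR (- A).
Proof.
move=> A0 th1 q2; set q := expR _ in q2.
apply: (@le_trans _ _ (\sum_(k < K) expR (- A) * q ^+ k)).
  apply: ler_sum => k _; rewrite -expRN /q -expRM_natl -expRD ler_expR.
  have := ler_wpM2l A0 (bernoulli_ge k th1).
  by move: (th ^+ k) (k%:R : R) => z m; clear; lra.
rewrite -mulr_sumr mulrC ler_wpM2r ?expR_ge0//.
apply: le_trans (geometric_sum_le _ _) _; first by rewrite expR_ge0/=; lra.
by rewrite invf_ple ?posrE; lra.
Qed.

Lemma detour_length (R : realFieldType) (z k n : R) :
  k <= z + 1 -> n + k + (1 + (n + k)) <= 2 * z + (2 * n + 3).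
Proof. lra. Qed.

Section upper_bound.
Context {R : realType} {d : nat} {alpha lambda tau : R} {l : R -> R}
  {mu : probability R R} {disp : measure_display}
  {T : measurableType disp} {P : probability T R}
  {W : site d -> {RV P >-> R}} {G : T -> rel (site d)}.
Hypotheses (d1 : (1 <= d)%N) (d_alpha : d%:R < alpha) (lambda0 : 0 < lambda)
  (tau1 : 1 < tau) (law : weight_law tau l mu)
  (sfp : scale_free_percolation alpha lambda mu W G).
Variable gamma : R.
Hypotheses (gammaE : gamma = alpha * (tau - 1) / d%:R)
  (gamma1 : 1 < gamma) (gamma2 : gamma < 2).

Lemma distance_upper_bound (c eta : R) : 0 < c -> 1 < c * `|ln (gamma - 1)| ->
  0 < eta ->
  exists M0 K0 : R, forall x : site d, M0 < enorm R x ->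
  exists U : set T, [/\ measurable U, (P U <= eta%:E)%E &
    forall w, ~ U w -> exists p, [/\ path (G w) 0 p, last 0 p = x &
      (size p)%:R <= 2 * c * ln (ln (enorm R x)) + K0]].
Proof.
move=> c0 ck eta0.
have d0 : 0 < d%:R :> R by rewrite ltr0n.
have a0 : 0 < alpha by exact: lt_trans d_alpha.
have k0 : 0 < gamma - 1 by rewrite subr_gt0.
have lnk : ln (gamma - 1) < 0 by rewrite ln_lt0// k0 ltrBlDr.
(* c |log kappa| > 1 means theta < 1/kappa, while theta^(c L) = e^L = log |x|. *)
pose th := expR c^-1.
have th1 : 1 < th by rewrite expR_gt1 invr_gt0.
have th0 : 0 < th by exact: expR_gt0.
have kth : (gamma - 1) * th < 1.
  rewrite -[X in X * th]lnK ?posrE// -expRD expR_lt1.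
  move: ck; rewrite ltr0_norm// -ltr_pdivrMl// mulr1.
  by rewrite [ln _ + _]addrC -ltrBrDr sub0r.
have [rho [vs [rho0 tvs e1 e2]]] : exists rho vs, [/\ 0 < rho, tau - 1 < vs,
    0 < d%:R - rho * vs & 0 < rho + th * rho - th * alpha].
  apply: hub_exponent_choice => //.
  have -> : alpha * th * (tau - 1) = d%:R * (gamma * th).
    by rewrite gammaE; field; rewrite gt_eqF.
  by rewrite ltr_pM2l//; move: kth; rewrite mulrBl mul1r ltrBlDr.
(* Two hubs of equal scale: rho > alpha th / (1 + th) > alpha / 2 since th > 1. *)
have e3 : 0 < rho + 1 * rho - 1 * alpha.
  have : th * alpha < rho * (1 + th) by lra.
  have := ler_wpM2r (ltW a0) (ltW th1); nra.
have vs0 : 0 < vs by rewrite (lt_trans _ tvs)// subr_gt0.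
have [ct [T0 [ct0 T01 tailT]]] := tail_lower law vs0 tvs.
have [C1 C10 HC1] := powR_expR_bounded 0 ct0 e1.
pose lam' := lambda / (d%:R * 3) `^ alpha.
have lam'0 : 0 < lam' by rewrite divr_gt0// powR_gt0// mulr_gt0.
have [C2 C20 HC2] := powR_expR_bounded (d%:R + th * d%:R) lam'0 e2.
have [C3 C30 HC3] := powR_expR_bounded (d%:R + 1 * d%:R) lam'0 e3.
pose Cs := C1 + 4 ^+ d * C2.
have Cs0 : 0 <= Cs by rewrite addr_ge0// mulr_ge0// exprn_ge0.
have th10 : 0 < th - 1 by rewrite subr_gt0.
have half0 : 0 < 2^-1 :> R by rewrite invr_gt0.
have [A1 A11 HA1] := expR_decay 1 th10 half0.
have [A2 A21 HA2] := expR_decay (4 * Cs + 4 ^+ d * C3) ltr01 eta0.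
have [A3 A31 HA3] := expR_decay T0 rho0 ltr01.
(* A1 makes the sum over scales geometric; A2 bounds the total error, 2 Cs e^(-A) for each of two
   chains plus the final pair; A3 puts every threshold (X k)^rho in the range of the tail bound. *)
pose A := Num.max A1 (Num.max A2 A3).
have {}HA1 : expR (- ((th - 1) * A)) <= 2^-1.
  by rewrite -[leLHS]mul1r; apply: HA1; rewrite le_max lexx.
have {}HA2 : (4 * Cs + 4 ^+ d * C3) * expR (- A) <= eta.
  by rewrite -[X in - X]mul1r; apply: HA2; rewrite !le_max lexx orbT.
have {}HA3 : T0 <= expR (rho * A).
  rewrite -[leRHS]mul1r -ler_pdivrMr ?expR_gt0// -expRN.
  by apply: HA3; rewrite !le_max lexx !orbT.
have A_ge1 : 1 <= A by rewrite le_max A11.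
have A0 : 0 < A by exact: lt_le_trans A_ge1.
pose X k := expR (A * th ^+ k).
have X1 k : 1 <= X k.
  by rewrite /X -(@expR0 R) ler_expR mulr_ge0 ?exprn_ge0 ?(ltW A0) ?(ltW th0).
have XS k : X k.+1 = X k `^ th by rewrite /X -expRM exprS mulrCA mulrC.
have Xmono k : X k <= X k.+1.
  by rewrite /X ler_expR ler_pM2l// exprS ler_peMl ?exprn_ge0// ltW.
have tT k : T0 <= X k `^ rho.
  rewrite (le_trans HA3)// /X -expRM ler_expR mulrC ler_pM2r//.
  by rewrite ler_peMr ?(ltW A0)// exprn_ege1// ltW.
pose n k := (Num.truncn (X k)).+1.
have nX k : X k <= (n k)%:R by exact/ltW/truncnS_gt.
have nX2 k : (n k)%:R <= 2 * X k.
  by rewrite /n -natr1 mulr_natl mulr2n lerD// truncn_le (le_trans ler01).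
have nmono k : (n k <= n k.+1)%N by rewrite ltnS le_truncn.
pose t k := X k `^ rho.
pose hub y k := no_hub (W := W) (box y (n k)) (t k).
pose mis y k := missing_edges (W := W) (G := G) (box y (n k)) (box y (n k.+1)) (t k) (t k.+1).
have mhub y k : measurable (hub y k) by exact: no_hub_measurable.
have mmis y k : measurable (mis y k) by exact: missing_edges_measurable sfp _ _ _ _.
have Phub y k : (P (hub y k) <= (C1 * (X k)^-1)%:E)%E.
  apply: le_trans (no_hub_box (vs := vs) sfp _ (ltW ct0) (X1 k) (nX k) (tailT _ (tT k))) _.
  by rewrite lee_fin; have := HC1 _ (X1 k); rewrite powRr0 mul1r.
have Pmis y k : (P (mis y k) <= (4 ^+ d * C2 * (X k)^-1)%:E)%E.
  rewrite /mis /t XS.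
  apply: le_trans (missing_box (th := th) sfp lambda0 a0 d1 _ (X1 k) (nX2 k) _ (nmono k) _) _.
  - by rewrite -XS; exact: nX2.
  - by rewrite subrr enorm0 powR_ge0.
  - by rewrite lee_fin -[leRHS]mulrA ler_wpM2l ?exprn_ge0//; exact: HC2.
have [N0 HN0] := box_reach sfp (n 0%N).
exists (expR 1), (2 * N0%:R + 3) => x xL.
set nx := enorm R x in xL *.
have nx0 : 0 < nx by exact: lt_trans (expR_gt0 _) xL.
have lnn1 : 1 < ln nx by rewrite -(expRK 1) ltr_ln ?posrE ?expR_gt0.
have lnn0 : 0 < ln nx by exact: lt_trans lnn1.
pose L := ln (ln nx).
have L0 : 0 < L by exact: ln_gt0.
have eL : expR L = ln nx by rewrite /L lnK.
have cL0 : 0 <= c * L by rewrite mulr_ge0 ?(ltW c0) ?(ltW L0).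
pose K := (Num.truncn (c * L)).+1.
have Kgt : c * L < K%:R by exact: truncnS_gt.
have Kle : K%:R <= c * L + 1 by rewrite -natr1 lerD2r truncn_le.
(* K > c L gives theta^K >= log |x|, and A >= 1: the last boxes are at least as large as the
   distance between their corners. *)
have XK : nx <= X K.
  rewrite -[nx]lnK ?posrE// /X ler_expR -eL.
  apply: (@le_trans _ _ (th ^+ K)); last by rewrite ler_peMl ?exprn_ge0 ?(ltW th0).
  by rewrite /th -expRM_natl ler_expR ler_pdivlMr// mulrC ltW.
pose fin := missing_edges (W := W) (G := G) (box 0 (n K)) (box x (n K)) (t K) (t K).
have mfin : measurable fin by exact: missing_edges_measurable sfp _ _ _ _.
have Pfin : (P fin <= (4 ^+ d * C3 * (X K)^-1)%:E)%E.
  have X11 : X K `^ 1 = X K by rewrite powRr1// (le_trans ler01).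
  have := missing_box (th := 1) (n := n K) (n' := n K) (y := 0) (y' := x)
    sfp lambda0 a0 d1 rho (X1 K) (nX2 K).
  rewrite X11 subr0 => /(_ (nX2 K) (leqnn _) XK) H.
  apply: le_trans H _.
  by rewrite lee_fin -[leRHS]mulrA ler_wpM2l ?exprn_ge0//; exact: HC3.
pose E y k := hub y k `|` mis y k.
have mE y k : measurable (E y k) by exact: measurableU (mhub y k) (mmis y k).
pose B y := \bigcup_(k < K.+1) E y k.
have mB y : measurable (B y) by apply: bigcup_measurable => k _; exact: mE.
have PB y : (P (B y) <= (Cs * (2 * expR (- A)))%:E)%E.
  apply: le_trans.
    apply: (@finite_union_bound _ _ _ P K.+1 (E y) (fun k => Cs * (X k)^-1)) => //.
      by move=> k; rewrite mulr_ge0// invr_ge0 (le_trans ler01).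
    move=> k _; apply: le_trans (measureU2 P (mhub y k) (mmis y k)) _.
    by rewrite /Cs mulrDl EFinD; apply: leeD; [exact: Phub|exact: Pmis].
  rewrite lee_fin -mulr_sumr ler_wpM2l// inverse_sum_le// ltW//.
exists (B 0 `|` (B x `|` fin)); split.
- exact: measurableU (mB 0) (measurableU _ _ (mB x) mfin).
- apply: le_trans (measureU2 P (mB 0) (measurableU _ _ (mB x) mfin)) _.
  apply: (@le_trans _ _ ((Cs * (2 * expR (- A)))%:E + ((Cs * (2 * expR (- A)))%:E +
    (4 ^+ d * C3 * (X K)^-1)%:E))%E).
    apply: leeD; first exact: PB.
    by apply: le_trans (measureU2 P (mB x) mfin) _; apply: leeD; first exact: PB.
  rewrite -!EFinD lee_fin; apply: le_trans HA2.
  have XA : (X K)^-1 <= expR (- A).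
    by rewrite expRN lef_pV2 ?posrE ?expR_gt0// /X ler_expR ler_peMr ?(ltW A0)// exprn_ege1// ltW.
  have C4 : 0 <= 4 ^+ d * C3 by rewrite mulr_ge0// exprn_ge0.
  have := ler_wpM2l C4 XA.
  by move: (4 ^+ d * C3) (expR (- A)) (X K)^-1 (Cs) => a b e f; lra.
- move=> w /not_orP[nB0 /not_orP[nBx nfin]].
  have chain y : ~ B y w -> exists h, [/\ h \in box y (n K), t K < W h w &
      reach (G w) y h (N0 + K)].
    move=> nB.
    have H1 k : (k <= K)%N -> ~ hub y k w.
      by move=> kK Hk; apply: nB; exists k; [exact: kK|left].
    have H2 k : (k < K)%N -> ~ mis y k w.
      by move=> kK Hk; apply: nB; exists k; [exact: ltnW|right].
    exact: (hub_chain (fun z => HN0 w y z) H1 H2 (leqnn K)).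
  have [h [hb th_ rh]] := chain 0 nB0.
  have [h' [hb' th' rh']] := chain x nBx.
  have r1 := not_missing_reach nfin hb hb' th_ th'.
  have [p [pp lp sp]] := reach_trans rh (reach_trans r1 (reach_sym (sfp_edge_sym sfp w) rh')).
  exists p; split => //.
  apply: (@le_trans _ _ (N0 + K + (1 + (N0 + K)))%:R); first by rewrite ler_nat.
  by rewrite !natrD -/L -(mulrA 2); exact: detour_length.
Qed.

End upper_bound.

(** * The graph distance as a random variable *)

Lemma graph_dist_eq (R : realType) (V : Type) (e : rel V) (x y : V) (n : nat) :
  (exists p, [/\ path e x p, last x p = y & size p = n]) ->
  (forall p, path e x p -> last x p = y -> (n <= size p)%N) ->
  graph_dist R e x y = (n%:R)%:E.
Proof.
move=> [p [pp lp sp]] Hn; apply/eqP; rewrite eq_le; apply/andP; split.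
  by apply: ereal_inf_lbound; exists p => //; rewrite sp.
apply: le_ereal_inf_tmp => _ [q [pq lq] <-].
by rewrite lee_fin ler_nat Hn.
Qed.

Lemma graph_dist_attained (R : realType) (V : Type) (e : rel V) (x y : V) (p : seq V) :
  path e x p -> last x p = y ->
  exists q, [/\ path e x q, last x q = y, (size q <= size p)%N,
    graph_dist R e x y = ((size q)%:R)%:E &
    forall p, path e x p -> last x p = y -> (size q <= size p)%N].
Proof.
move=> pp lp.
have ex : exists n, `[< exists p, [/\ path e x p, last x p = y & size p = n] >].
  by exists (size p); apply/asboolP; exists p.
have [n /asboolP[q [pq lq sq]] nmin] := ex_minnP ex.
have qmin r : path e x r -> last x r = y -> (size q <= size r)%N.
  by move=> pr lr; rewrite sq; apply: nmin; apply/asboolP; exists r.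
exists q; split => //; first exact: qmin.
by apply: graph_dist_eq => //; exists q.
Qed.

Lemma cvg_to_0e (R : realType) (d : nat) (f : site d -> \bar R) :
  (forall x, (0 <= f x)%E) ->
  (forall eta : R, 0 < eta -> exists M : R, forall x : site d, M < enorm R x ->
    (f x <= eta%:E)%E) ->
  f x @[x --> norm_to_infinity R d] --> 0%E.
Proof.
move=> f0 H; apply/fine_cvgP; split.
  have [M HM] := H 1 ltr01; exists M => // x /HM fx.
  by rewrite ge0_fin_numE// (le_lt_trans fx)// ltry.
apply/cvgrPdist_le => eta eta0; have [M HM] := H eta eta0.
exists M => // x /HM fx /=.
rewrite sub0r normrN ger0_norm ?fine_ge0// -lee_fin fineK//.
by rewrite ge0_fin_numE// (le_lt_trans fx)// ltry.
Qed.

Section measurability.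
Context {R : realType} {d : nat} {alpha lambda : R} {mu : probability R R}
  {disp : measure_display} {T : measurableType disp} {P : probability T R}
  {W : site d -> {RV P >-> R}} {G : T -> rel (site d)}.
Hypothesis sfp : scale_free_percolation alpha lambda mu W G.

(** The lattice is connected for every outcome, so the distance is always a natural number; its
    level sets involve countably many paths, which allows an arbitrary [Q]. *)
Lemma graph_dist_measurable (x y : site d) (Q : \bar R -> Prop) :
  measurable [set w | Q (graph_dist R (G w) x y)].
Proof.
pose F n : set T := \bigcup_(p in [set p | size p = n])
  (if last x p == y then [set w | path (G w) x p] else set0).
have mF n : measurable (F n).
  apply: (bigcup_seq_measurable (E := fun p =>
    if last x p == y then [set w | path (G w) x p] else set0)) => p.
  by case: ifP => // _; exact: path_measurable sfp _ _.
have FP n w : F n w <-> exists p, [/\ path (G w) x p, last x p = y & size p = n].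
  split=> [[p /= pn]|[p [pp lp sp]]].
    by case: eqP => // lp pp; exists p.
  by exists p => //=; rewrite lp eqxx.
have [N HN] := lattice_reach sfp (y - x).
pose E n := F n `&` \bigcap_(m < n) ~` F m.
have mE n : measurable (E n).
  apply: measurableI => //; apply: fin_bigcap_measurable => // m _.
  exact: measurableC.
have EP n w : E n w -> graph_dist R (G w) x y = (n%:R)%:E.
  move=> [/FP Fn Hm]; apply: graph_dist_eq => // p pp lp.
  rewrite leqNgt; apply/negP => pn; apply: (Hm _ pn); apply/FP.
  by exists p.
have -> : [set w | Q (graph_dist R (G w) x y)] =
    \bigcup_n (if `[< Q (n%:R)%:E >] then E n else set0).
  apply/seteqP; split => w /=.
    move=> Qw; have [p0 [pp0 lp0 _]] := HN w x; rewrite addrC subrK in lp0.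
    have [q [pq lq _ Dq qmin]] := graph_dist_attained R pp0 lp0.
    exists (size q) => //; rewrite -Dq; case: asboolP => // _; split.
      by apply/FP; exists q.
    move=> m /= mq /FP[r [pr lr sr]].
    by move: mq; rewrite -sr ltnNge qmin.
  by move=> [n _]; case: asboolP => // Qn /EP ->.
apply: bigcupT_measurable => n; by case: ifP.
Qed.

End measurability.

Lemma between_abs (R : realFieldType) (n L q eps c1 c2 K0 : R) :
  0 < L -> 2 * c1 * L < n -> n <= 2 * c2 * L + K0 ->
  q - eps <= 2 * c1 -> 2 * c2 = q + eps / 2 -> K0 <= eps / 2 * L ->
  `|n * L^-1 - q| <= eps.
Proof.
move=> L0 nl nu c1q c2q K0L.
have h1 : (q - eps) * L <= n.
  by apply: le_trans (ltW nl); rewrite ler_pM2r.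
have h2 : n <= (q + eps) * L by rewrite c2q in nu; lra.
rewrite ler_distl; apply/andP; split.
  by rewrite ler_pdivlMr.
by rewrite ler_pdivrMr.
Qed.

Theorem corollary1p4 (R : realType) (d : nat) (alpha lambda tau : R)
  (l : R -> R) (mu : probability R R) (disp : measure_display)
  (T : measurableType disp) (P : probability T R)
  (W : site d -> {RV P >-> R}) (G : T -> rel (site d)) :
  (1 <= d)%N -> d%:R < alpha -> 0 < lambda -> 1 < tau ->
  weight_law tau l mu ->
  scale_free_percolation alpha lambda mu W G ->
  let gamma := alpha * (tau - 1) / d%:R in
  1 < gamma -> gamma < 2 ->
  forall eps : R, 0 < eps ->
  P [set w | (eps%:E < `| graph_dist R (G w) 0%R x * ((ln (ln (enorm R x)))^-1)%:E
                          - (2 / `| ln (gamma - 1) |)%:E |)%E]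
    @[x --> norm_to_infinity R d] --> 0%E.
Proof.
move=> d1 d_alpha lambda0 tau1 law sfp gamma gamma1 gamma2 eps eps0.
have gammaE : gamma = alpha * (tau - 1) / d%:R by [].
move: gamma gammaE gamma1 gamma2 => gamma gammaE gamma1 gamma2.
apply: cvg_to_0e => [x|eta eta0]; first exact: measure_ge0.
have k0 : 0 < gamma - 1 by rewrite subr_gt0.
have lnk : 0 < `|ln (gamma - 1)|.
  by rewrite normr_gt0 lt_eqF// ln_lt0// k0 ltrBlDr.
set a := `|ln (gamma - 1)| in lnk *.
pose q := 2 / a; have q0 : 0 < q by rewrite divr_gt0.
have qa : q * a = 2 by rewrite /q divfK ?gt_eqF.
have eta2 : 0 < eta / 2 by rewrite divr_gt0.
have [c1 [c10 c1a c1q]] : exists c1, [/\ 0 < c1, c1 * a < 1 & q - eps <= 2 * c1].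
  (* (q - eps) / 2 may fail to be positive when eps is large; q / 4 keeps c1 positive and still
     below 1 / a. *)
  exists (Num.max ((q - eps) / 2) (q / 4)); split.
  - by rewrite lt_max (divr_gt0 q0)// orbT.
  - rewrite maxr_pMl ?(ltW lnk)// gt_max; apply/andP; split.
      by have := mulr_gt0 eps0 lnk; lra.
    by lra.
  - rewrite maxr_pMr// le_max; apply/orP; left; lra.
(* Half of eps goes into 2 c2; the other half absorbs K0 / L for large L. *)
pose c2 := q / 2 + eps / 4.
have c20 : 0 < c2 by rewrite addr_gt0// divr_gt0.
have c2a : 1 < c2 * a.
  by rewrite /c2 mulrDl; have := mulr_gt0 eps0 lnk; lra.
have c2q : 2 * c2 = q + eps / 2 by rewrite /c2; lra.
have [M1 HM1] := distance_lower_bound d1 d_alpha lambda0 law sfp gammaE gamma1 gamma2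
  c10 c1a eta2.
have [M2 [K0 HM2]] := distance_upper_bound d1 d_alpha lambda0 tau1 law sfp gammaE
  gamma1 gamma2 c20 c2a eta2.
pose L0 := Num.max 1 (K0 / (eps / 2)).
exists (Num.max M1 (Num.max M2 (expR (expR L0)))) => x.
rewrite !gt_max => /and3P[/HM1[U1 [mU1 PU1 HU1]] /HM2[U2 [mU2 PU2 HU2]] xL].
have L0x : L0 < ln (ln (enorm R x)).
  have x0 : 0 < enorm R x by exact: lt_trans (expR_gt0 _) xL.
  have x1 : expR L0 < ln (enorm R x) by rewrite -(expRK (expR L0)) ltr_ln ?posrE ?expR_gt0.
  rewrite -(expRK L0) ltr_ln ?posrE ?expR_gt0//.
  exact: lt_trans (expR_gt0 _) x1.
set L := ln (ln _) in L0x HU1 HU2 *.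
have L_gt0 : 0 < L.
  by apply: lt_trans L0x; rewrite lt_max ltr01.
have K0L : K0 <= eps / 2 * L.
  rewrite mulrC -ler_pdivrMr ?divr_gt0//; apply: le_trans (ltW L0x).
  by rewrite le_max lexx orbT.
apply: (@le_trans _ _ (P (U1 `|` U2))).
  apply: le_measure; rewrite ?inE.
  - exact: (graph_dist_measurable sfp 0 x
      (fun D => (eps%:E < `| D * (L^-1)%:E - (2 / a)%:E |)%E)).
  - exact: measurableU.
  - move=> w /= Hw; apply: contrapT => /not_orP[/HU1 low /HU2[p [pp lp sp]]].
    have [r [pr lr sr Dr _]] := graph_dist_attained R pp lp.
    move: Hw; rewrite Dr -EFinM -EFinB abse_EFin lte_fin ltNge => /negP; apply.
    apply: (between_abs L_gt0 (low r pr lr) _ c1q c2q K0L).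
    by apply: le_trans sp; rewrite ler_nat.
apply: le_trans (measureU2 P mU1 mU2) _.
by rewrite [eta]splitr EFinD leeD.
Qed.
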